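(* Let $d, n \ge 1$ be integers, let $\alpha_1,\dots,\alpha_d \in \mathbb{R}\setminus\{0\}$ and $\beta_1,\dots,\beta_d \in \mathbb{R}$, and let $f : [-1,1]^d \times \mathbb{R}^{d+1} \to \mathbb{R}$ be the generic quadratic model $$f(x,\theta) = \theta_0 + \sum_{k=1}^d \alpha_k \theta_k x_k + \sum_{k=1}^d \beta_k \frac{\theta_k^2}{2} x_k^2, \qquad \theta = (\theta_0,\theta_1,\dots,\theta_d).$$ Let $\tilde{x} = (x_1,\dots,x_n)$ be a design with $x_i = (x_{i,1},\dots,x_{i,d}) \in \{-1,1\}^d$ for all $i$, $\sum_{i=1}^n x_i = 0$, and $\sum_{i=1}^n x_{i,k} x_{i,l} = n\,\delta_{k,l}$ for all $k,l \in \{1,\dots,d\}$. Let $\theta^* \in \mathbb{R}^{d+1}$ and $\sigma > 0$ be arbitrary, let $\tilde{y}(\tilde{x}) = (f(x_i,\theta^* ) + \varepsilon_i)_{i=1,\dots,n}$ with $\varepsilon_1,\dots,\varepsilon_n$ independent $\mathcal{N}(0,\sigma^2)$ random variables, and suppose the available observations are noise-free, i.e. $\tilde{y} = (f(x_1,\theta^* ),\dots,f(x_n,\theta^* )) \in \mathbb{R}^n$. Let $V_{\tilde{x}}$ be the exact prediction uncertainty and let $V^{\mathrm{LIN}}_{\tilde{x},\tilde{y}}$, $V^{\mathrm{SP}}_{\tilde{x},\tilde{y}}$, $V^{\mathrm{MS}}_{\tilde{x},\tilde{y}}$, $V^{\mathrm{LD}}_{\tilde{x},\tilde{y}}$ be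 its linearization, sigma-point, McNamee--Stenger and Lu--Darmofal approximations. Then: (i) If the $\beta_k$ are all non-zero with the same sign (that is, $\beta_k < 0$ for all $k$, or $\beta_k > 0$ for all $k$), then for every sigma-point parameter $\kappa \in (2n,\infty)$, $$V^{\mathrm{LIN}}_{\tilde{x},\tilde{y}}(x) < V_{\tilde{x}}(x) < V^{\mathrm{SP}}_{\tilde{x},\tilde{y}}(x) \qquad \text{for all } x \in [-1,1]^d \setminus \{-1,1\}^d.$$ (ii) For all $x \in [-1,1]^d$, $$V^{\mathrm{MS}}_{\tilde{x},\tilde{y}}(x) = V_{\tilde{x}}(x) = V^{\mathrm{LD}}_{\tilde{x},\tilde{y}}(x).$$
   Context: In the definition of $f$, $x_k$ denotes the $k$th component of $x$; design points are $x_i$ with components $x_{i,k}$. $\delta_{k,l}$ is the Kronecker delta. For a model $m : [-1,1]^d\times\mathbb{R}^{d+1} \to \mathbb{R}$ and $\tilde{y} \in \mathbb{R}^n$, $\hat{\theta}_m(\tilde{x},\tilde{y})$ denotes the least-squares estimator, i.e. the minimizer over $\theta \in \mathbb{R}^{d+1}$ of $\sum_{i=1}^n (y_i - m(x_i,\theta))^2$ (for the designs considered here it exists and is unique both for $m = f$ and for the linearized model below). Exact prediction uncertainty: $V_{\tilde{x}}(x) = \mathrm{Var}\big[f(x,\hat{\theta}_f(\tilde{x},\tilde{y}(\tilde{x})))\big]$. Given observations $\tilde{y} \in \mathbb{R}^n$, put $\bar{\theta} = \hat{\theta}_f(\tilde{x},\tilde{y})$, $\tilde{\bar{y}} = (f(x_1,\bar{\theta}),\dots,f(x_n,\bar{\theta}))$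 and, for $\tilde{z} \in \mathbb{R}^n$, $g(x,\tilde{z}) = f\big(x,\hat{\theta}_f(\tilde{x},\tilde{\bar{y}}+\tilde{z})\big)$. Linearization: with $f^{\mathrm{LIN}}_{\bar{\theta}}(x,\theta) = f(x,\bar{\theta}) + \nabla_\theta f(x,\bar{\theta})^T(\theta-\bar{\theta})$, set $V^{\mathrm{LIN}}_{\tilde{x},\tilde{y}}(x) = \mathrm{Var}\big[f^{\mathrm{LIN}}_{\bar{\theta}}(x,\hat{\theta}_{f^{\mathrm{LIN}}_{\bar{\theta}}}(\tilde{x},\tilde{y}(\tilde{x})))\big]$, where $\bar{\theta}$ is fixed and the variance is over the random $\tilde{y}(\tilde{x})$. Cubature approximations: each of SP, MS, LD is given by a linear functional $Q$ on functions $\varphi : \mathbb{R}^n \to \mathbb{R}$; the corresponding approximations are $\mu^{Q}(x) = Q[g(x,\cdot)]$ and $V^{Q}_{\tilde{x},\tilde{y}}(x) = Q\big[(g(x,\cdot)-\mu^{Q}(x))^2\big]$. Let $e_1,\dots,e_n$ be the canonical unit vectors of $\mathbb{R}^n$. SP (sigma points, parameter $\kappa \in (-n,\infty)$): $Q[\varphi] = w_0\varphi(0) + w_1\sum_{i=1}^n(\varphi(\delta e_i)+\varphi(-\delta e_i))$ with $\delta = \sqrt{n+\kappa}\,\sigma$, $w_0 = \frac{\kappa}{n+\kappa}$, $w_1 = \frac{1}{2(n+\kappa)}$. MS (McNamee--Stenger): $$Q[\varphi] = w_0\varphi(0) + w_1\sum_{i=1}^n(\varphi(\delta e_i)+\varphi(-\delta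 e_i)) + w_2\sum_{i=1}^n\sum_{j=1}^{i-1}\big(\varphi(\delta(e_i+e_j))+\varphi(-\delta(e_i+e_j))+\varphi(\delta(e_i-e_j))+\varphi(-\delta(e_i-e_j))\big)$$ with $I_0 = 1$, $I_2 = \sigma^2$, $I_4 = 3\sigma^4$, $I_{2,2} = \sigma^4$, $\delta = (I_4/I_2)^{1/2} = \sqrt{3}\,\sigma$, $w_0 = I_0 - n(I_2/I_4)^2\big(I_4 - \frac{n-1}{2}I_{2,2}\big)$, $w_1 = \frac{(I_2/I_4)^2}{2}\big(I_4-(n-1)I_{2,2}\big)$, $w_2 = \frac{(I_2/I_4)^2}{4}I_{2,2}$. LD (Lu--Darmofal; note $n \ge 2$ for the designs considered): $$Q[\varphi] = w_0\varphi(0) + w_1\sum_{i=1}^{n+1}(\varphi(\delta a^{(i)})+\varphi(-\delta a^{(i)})) + w_2\sum_{i=1}^{n+1}\sum_{j=1}^{i-1}(\varphi(\delta b^{(i,j)})+\varphi(-\delta b^{(i,j)}))$$ with $\delta = \sqrt{n+2}\,\sigma$, $w_0 = \frac{2}{n+2}$, $w_1 = \frac{n^2(7-n)}{2(n+1)^2(n+2)^2}$, $w_2 = \frac{2(n-1)^2}{(n+1)^2(n+2)^2}$, where $a^{(i)} \in \mathbb{R}^n$ ($i = 1,\dots,n+1$) has components, for $k \in \{1,\dots,n\}$, $$a^{(i)}_k = -\sqrt{\tfrac{n+1}{n(n-k+2)(n-k+1)}} \ (k<i), \qquad a^{(i)}_i = \sqrt{\tfrac{(n+1)(n-i+1)}{n(n-i+2)}}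 \ (k=i), \qquad a^{(i)}_k = 0 \ (k>i),$$ and $b^{(i,j)} = \sqrt{\tfrac{n}{2(n-1)}}\,(a^{(i)}+a^{(j)})$ for $j<i$. *)

(* Defs.v *)
From HB Require Import structures.
From mathcomp Require Import all_boot all_order all_algebra.
From mathcomp Require Import all_classical all_reals all_analysis.

Set Implicit Arguments.
Unset Strict Implicit.
Unset Printing Implicit Defensive.

Import Order.TTheory GRing.Theory Num.Theory.
Import numFieldNormedType.Exports.

Local Open Scope classical_set_scope.
Local Open Scope ring_scope.

Definition cube (R : realType) (d : nat) : set 'rV[R]_d :=
  [set x | forall k, -1 <= x 0 k <= 1].

Definition vertices (R : realType) (d : nat) : set 'rV[R]_d :=
  [set x | forall k, x 0 k = -1 \/ x 0 k = 1].

Arguments cube : clear implicits.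
Arguments vertices : clear implicits.

(* Models are total in x, although only points of [cube R d] matter.  The entry
   [theta 0 ord0] is the intercept theta_0 and [theta 0 (lift ord0 k)] is the
   parameter attached to the input component [x 0 k]. *)
Definition model (R : realType) (d : nat) := 'rV[R]_d -> 'rV[R]_d.+1 -> R.

Definition quad_model (R : realType) (d : nat) (alpha beta : 'I_d -> R) :
    model R d :=
  fun x theta => theta 0 ord0
    + \sum_(k < d) alpha k * theta 0 (lift ord0 k) * x 0 k
    + \sum_(k < d) beta k * (theta 0 (lift ord0 k) ^+ 2 / 2) * x 0 k ^+ 2.

Definition model_values (R : realType) (d n : nat) (m : model R d)
    (xs : 'I_n -> 'rV[R]_d) (theta : 'rV[R]_d.+1) : 'rV[R]_n :=
  \row_(i < n) m (xs i) theta.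

Section LeastSquares.
Context (R : realType) (d n : nat).
Implicit Types (m : model R d) (xs : 'I_n -> 'rV[R]_d) (y : 'rV[R]_n).

Definition sum_squares m xs y (theta : 'rV[R]_d.+1) : R :=
  \sum_(i < n) (y 0 i - m (xs i) theta) ^+ 2.

(* A minimizer of the sum of squares; the default value 0 is only returned
   when there is none. *)
Definition lse m xs y : 'rV[R]_d.+1 :=
  xget 0 [set theta | forall theta',
                        sum_squares m xs y theta <= sum_squares m xs y theta'].

Definition gradient (h : 'rV[R]_d.+1 -> R) (theta : 'rV[R]_d.+1) :
    'rV[R]_d.+1 :=
  \row_(j < d.+1) 'D_(delta_mx 0 j) h theta.

Definition linearized m (thetabar : 'rV[R]_d.+1) : model R d :=
  fun x theta => m x thetabar
    + \sum_(j < d.+1) gradient (m x) thetabar 0 j * (theta - thetabar) 0 j.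

(* g(x, z), for the observations y *)
Definition perturbed_prediction m xs y (x : 'rV[R]_d) (z : 'rV[R]_n) : R :=
  m x (lse m xs (model_values m xs (lse m xs y) + z)).

End LeastSquares.

Section Uncertainty.
Context (disp : measure_display) (T : measurableType disp) (R : realType)
  (P : probability T R) (d n : nat).

(* Mutual independence of a finite family of real random variables. *)
Definition mutually_independent (X : 'I_n -> {RV P >-> R}) : Prop :=
  forall (J : {set 'I_n}) (A : 'I_n -> set R),
    (forall i, i \in J -> measurable (A i)) ->
    P (\bigcap_(i in [set` J]) (X i @^-1` A i)) =
    (\prod_(i in J) P (X i @^-1` A i))%E.

Definition noisy_observations (m : model R d) (xs : 'I_n -> 'rV[R]_d)
    (theta : 'rV[R]_d.+1) (eps : 'I_n -> {RV P >-> R}) : T -> 'rV[R]_n :=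
  fun w => \row_(i < n) (m (xs i) theta + eps i w).

Definition V_exact (m : model R d) (xs : 'I_n -> 'rV[R]_d)
    (Y : T -> 'rV[R]_n) (x : 'rV[R]_d) : \bar R :=
  ('V_P[fun w => m x (lse m xs (Y w))])%E.

(* The linearization point is computed from the given observations [y]; the
   variance is taken over the random observations [Y]. *)
Definition V_LIN (m : model R d) (xs : 'I_n -> 'rV[R]_d) (y : 'rV[R]_n)
    (Y : T -> 'rV[R]_n) (x : 'rV[R]_d) : \bar R :=
  V_exact (linearized m (lse m xs y)) xs Y x.

End Uncertainty.

Section Cubature.
Context (R : realType) (n : nat).
Implicit Types (phi : 'rV[R]_n -> R) (sigma : R).

Definition unit_vec (i : 'I_n) : 'rV[R]_n := delta_mx 0 i.

Definition Q_SP (kappa sigma : R) phi : R :=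
  let delta := Num.sqrt (n%:R + kappa) * sigma in
  let w0 := kappa / (n%:R + kappa) in
  let w1 := 1 / (2 * (n%:R + kappa)) in
  w0 * phi 0
  + w1 * \sum_(i < n) (phi (delta *: unit_vec i) + phi (- (delta *: unit_vec i))).

Definition Q_MS sigma phi : R :=
  let I0 := 1 in
  let I2 := sigma ^+ 2 in
  let I4 := 3 * sigma ^+ 4 in
  let I22 := sigma ^+ 4 in
  let delta := Num.sqrt (I4 / I2) in
  let w0 := I0 - n%:R * (I2 / I4) ^+ 2 * (I4 - (n%:R - 1) / 2 * I22) in
  let w1 := (I2 / I4) ^+ 2 / 2 * (I4 - (n%:R - 1) * I22) in
  let w2 := (I2 / I4) ^+ 2 / 4 * I22 in
  w0 * phi 0
  + w1 * \sum_(i < n) (phi (delta *: unit_vec i) + phi (- (delta *: unit_vec i)))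
  + w2 * \sum_(i < n) \sum_(j < n | (j < i)%N)
      (phi (delta *: (unit_vec i + unit_vec j))
       + phi (- (delta *: (unit_vec i + unit_vec j)))
       + phi (delta *: (unit_vec i - unit_vec j))
       + phi (- (delta *: (unit_vec i - unit_vec j)))).

(* Ordinals count from 0, whereas the usual formula for these n + 1 simplex
   vertices counts from 1: hence the shifted indices [i'] and [k']. *)
Definition LD_a (i : 'I_n.+1) : 'rV[R]_n :=
  \row_(k < n)
    let i' : R := i.+1%:R in
    let k' : R := k.+1%:R in
    let N : R := n%:R in
    if (k < i)%N then
      - Num.sqrt ((N + 1) / (N * (N - k' + 2) * (N - k' + 1)))
    else if k == i :> nat then
      Num.sqrt (((N + 1) * (N - i' + 1)) / (N * (N - i' + 2)))
    else 0.

Definition LD_b (i j : 'I_n.+1) : 'rV[R]_n :=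
  Num.sqrt (n%:R / (2 * (n%:R - 1))) *: (LD_a i + LD_a j).

Definition Q_LD sigma phi : R :=
  let N : R := n%:R in
  let delta := Num.sqrt (N + 2) * sigma in
  let w0 := 2 / (N + 2) in
  let w1 := N ^+ 2 * (7 - N) / (2 * (N + 1) ^+ 2 * (N + 2) ^+ 2) in
  let w2 := 2 * (N - 1) ^+ 2 / ((N + 1) ^+ 2 * (N + 2) ^+ 2) in
  w0 * phi 0
  + w1 * \sum_(i < n.+1) (phi (delta *: LD_a i) + phi (- (delta *: LD_a i)))
  + w2 * \sum_(i < n.+1) \sum_(j < n.+1 | (j < i)%N)
      (phi (delta *: LD_b i j) + phi (- (delta *: LD_b i j))).

Definition V_cubature (Q : ('rV[R]_n -> R) -> R) (d : nat) (m : model R d)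
    (xs : 'I_n -> 'rV[R]_d) (y : 'rV[R]_n) (x : 'rV[R]_d) : R :=
  let g := perturbed_prediction m xs y x in
  let mu := Q g in
  Q (fun z => (g z - mu) ^+ 2).

End Cubature.

(* Main.v *)
(* On a +-1 orthogonal design, the residual sum of squares splits orthogonally,
   so the least-squares fit reads off the empirical means of the y_i and of the
   y_i x_{i,k}. Hence the prediction at x is an explicit quadratic polynomial of
   the noise z,
     c + <w, z> + sum_k gamma_k <v_k, z>^2,  v_k = (x_{i,k} / n)_i,
     gamma_k = beta_k (x_k^2 - 1) / (2 alpha_k^2),
   with the v_k orthogonal of squared norm 1/n, and linearization drops the
   quadratic part. Any normalized linear functional with vanishing odd moments
   and second moments sigma^2 <., .> assigns to this polynomial a variance
     sigma^2 |w|^2 + sum_{k,l} gamma_k gamma_l (W(v_k,v_k,v_l,v_l) - sigma^4/n^2),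
   W being its tensor of fourth moments. The Gaussian measure, MS and LD share
   the Gaussian tensor, which gives 2 sigma^4/n^2 sum_k gamma_k^2; for SP the
   double sum is kappa sigma^4/n^3 (sum_k gamma_k)^2. For gamma_k of one sign and
   kappa > 2n the latter is the larger one. *)
Require Import Defs.
From HB Require Import structures.
From mathcomp Require Import all_boot all_order all_algebra.
From mathcomp Require Import all_classical all_reals all_analysis.
From mathcomp Require Import measurable_realfun ring lra.

Set Implicit Arguments.
Unset Strict Implicit.

Import Order.TTheory GRing.Theory Num.Theory.
Import numFieldNormedType.Exports.

Local Open Scope classical_set_scope.
Local Open Scope ring_scope.

(** The model is nonlinear in theta, but the design points are vertices, where x_k^2 = 1. On the
    design, f is therefore affine in x with coefficients theta_0 + sum_k beta_k theta_k^2 / 2 and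
    alpha_k theta_k. As alpha_k is nonzero, these coefficients determine theta and can take any
    values, so least squares is solved in these coordinates. At a general x the remainder sum_k
    beta_k theta_k^2 (x_k^2 - 1) / 2 is the only source of nonlinearity in z. The exact variance and
    the cubature variances come from a single computation, for a functional that is linear on a
    class of functions. The class matters because expectation is linear on integrable functions
    only, so every intermediate polynomial must be shown to belong to it. Squaring a quadratic
    polynomial calls for moments up to order four. Independence is given for events. The Gaussian
    moments thus require a product formula for integrals, besides the moments of one normal
    variable, which are computed from its density. *)

Definition linear_form (R : realType) (n : nat) (u : 'I_n -> R) (z : 'rV[R]_n) : R :=
  \sum_(i < n) u i * z 0 i.

(** Off h = 0 the difference quotient equals c1 + h c2. The hypothesis constrains [b] entrywise so
    that the entries of the parameter can be rewritten directly inside a model. *)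
Lemma derive_quadratic (R : realType) (d : nat) (F : 'rV[R]_d -> R)
    (a v : 'rV[R]_d) (c1 c2 : R) :
  (forall h (b : 'rV[R]_d), (forall j, b 0 j = h * v 0 j + a 0 j) ->
    F b = F a + h * c1 + h ^+ 2 * c2) -> 'D_v F a = c1.
Proof.
move=> hF; apply: cvg_lim => //.
rewrite [X in X @ _](_ : _ = fun h => h^-1 *: (h * c1 + h ^+ 2 * c2)); last first.
  apply/funext => h /=; congr (_ *: _).
  rewrite (hF h); first ring.
  by move=> j; rewrite !mxE.
have : c1 + h * c2 @[h --> 0^'] --> c1 + 0 * c2.
  apply: cvg_within_filter; apply: cvgD; first exact: cvg_cst.
  by apply: cvgM; [exact: cvg_id|exact: cvg_cst].
rewrite mul0r addr0; apply: cvg_trans; apply: near_eq_cvg.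
near=> h; have h0 : h != 0 by near: h; exact: nbhs_dnbhs_neq.
rewrite /GRing.scale/= mulrDr mulKf//; congr (_ + _).
by rewrite expr2 -mulrA mulKf.
Unshelve. all: by end_near. Qed.

(** * Least squares on an orthogonal design *)

Section LeastSquaresOrthogonalDesign.
Context (R : realType) (d n : nat) (xs : 'I_n -> 'rV[R]_d).
Hypothesis n_gt0 : (0 < n)%N.
Hypothesis xs_sum : \sum_(i < n) xs i = 0.
Hypothesis xs_orth : forall k l : 'I_d,
  \sum_(i < n) xs i 0 k * xs i 0 l = n%:R * (k == l)%:R.

Lemma design_sum k : \sum_(i < n) xs i 0 k = 0.
Proof.
have := congr1 (fun M : 'rV[R]_d => M 0 k) xs_sum.
by rewrite summxE mxE.
Qed.

(** Parseval: the constant column and the d coordinate columns of the design are orthogonal, each of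
    squared norm n. *)
Lemma design_affine_sumsq (a : R) (b : 'I_d -> R) :
  \sum_(i < n) (a + \sum_(k < d) b k * xs i 0 k) ^+ 2 =
  n%:R * (a ^+ 2 + \sum_(k < d) b k ^+ 2).
Proof.
have e i : (a + \sum_(k < d) b k * xs i 0 k) ^+ 2 =
    a ^+ 2 + \sum_k (a *+ 2 * b k) * xs i 0 k
    + \sum_k \sum_l (b k * b l) * (xs i 0 k * xs i 0 l).
  rewrite sqrrD; congr (_ + _ + _).
    by rewrite mulr_sumr -sumrMnl; apply: eq_bigr => k _; ring.
  rewrite expr2 mulr_suml; apply: eq_bigr => k _.
  by rewrite mulr_sumr; apply: eq_bigr => l _; ring.
under eq_bigr do rewrite e.
rewrite !big_split/= sumr_const card_ord [X in _ + X + _]exchange_big/=.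
rewrite [X in _ + X + _]big1 ?addr0; last first.
  by move=> k _; rewrite -mulr_sumr design_sum mulr0.
rewrite mulrDr mulr_natl; congr (_ + _).
rewrite exchange_big mulr_sumr/=; apply: eq_bigr => k _.
rewrite exchange_big/= (bigD1 k)//= [X in _ + X]big1 ?addr0.
  by rewrite -mulr_sumr xs_orth eqxx mulr1; ring.
by move=> l lk; rewrite -mulr_sumr xs_orth eq_sym (negbTE lk) !mulr0.
Qed.

(** Pythagoras: the residual at [that] is orthogonal to the constant and coordinate columns, hence
    to the difference of two fits. The coefficients [u] and [p] may depend on theta in any way,
    which covers both the quadratic model and its linearization. *)
Lemma sum_squares_decomposition (m : model R d) (u : 'rV[R]_d.+1 -> R)
    (p : 'I_d -> 'rV[R]_d.+1 -> R) (y : 'rV[R]_n) (that theta : 'rV[R]_d.+1) :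
  (forall i t, m (xs i) t = u t + \sum_(k < d) p k t * xs i 0 k) ->
  u that = n%:R^-1 * \sum_(i < n) y 0 i ->
  (forall k, p k that = n%:R^-1 * \sum_(i < n) y 0 i * xs i 0 k) ->
  sum_squares m xs y theta = sum_squares m xs y that +
    n%:R * ((u theta - u that) ^+ 2 + \sum_(k < d) (p k theta - p k that) ^+ 2).
Proof.
move=> hm hu hp.
have n0 : n%:R != 0 :> R by rewrite pnatr_eq0 -lt0n.
rewrite -design_affine_sumsq /sum_squares.
pose r i := y 0 i - m (xs i) that.
pose t i := (u theta - u that) + \sum_(k < d) (p k theta - p k that) * xs i 0 k.
have r_sum : \sum_i r i = 0.
  rewrite /r sumrB; under [X in _ - X]eq_bigr do rewrite hm.
  rewrite big_split/= sumr_const card_ord hu exchange_big/=.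
  rewrite [X in _ - (_ + X)]big1; last first.
    by move=> k _; rewrite -mulr_sumr design_sum mulr0.
  by rewrite addr0 -[(_ * _) *+ n]mulr_natl mulVKf// subrr.
have r_orth k : \sum_i r i * xs i 0 k = 0.
  rewrite /r; under eq_bigr do rewrite mulrBl hm mulrDl mulr_suml.
  rewrite sumrB big_split/= -mulr_sumr design_sum mulr0 add0r exchange_big/=.
  rewrite (bigD1 k)//= [X in _ - (_ + X)]big1 ?addr0; last first.
    move=> l lk; under eq_bigr do rewrite -mulrA.
    by rewrite -mulr_sumr xs_orth (negbTE lk) !mulr0.
  under [X in _ - X]eq_bigr do rewrite -mulrA.
  by rewrite -mulr_sumr xs_orth eqxx mulr1 hp mulrC mulVKf// subrr.
have rt : \sum_i r i * t i = 0.
  rewrite /t; under eq_bigr do rewrite mulrDr mulr_sumr.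
  rewrite big_split/= -mulr_suml r_sum mul0r add0r exchange_big/= big1// => k _.
  under eq_bigr do rewrite mulrCA.
  by rewrite -mulr_sumr r_orth mulr0.
have e i : (y 0 i - m (xs i) theta) ^+ 2 = r i ^+ 2 + t i ^+ 2 - (r i * t i) *+ 2.
  have -> : y 0 i - m (xs i) theta = r i - t i.
    rewrite /r /t !hm; under [X in _ = _ - (_ + X)]eq_bigr do rewrite mulrBl.
    by rewrite sumrB; ring.
  by rewrite sqrrB; ring.
under eq_bigr do rewrite e.
by rewrite sumrB big_split/= sumrMnl rt mul0rn subr0.
Qed.

(** [lse] is chosen among the minimizers, so one solution of the normal equations must control all
    of them. The decomposition does this, but only through the values of [u] and [p]. *)
Lemma lse_orthogonal_design (m : model R d) (u : 'rV[R]_d.+1 -> R)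
    (p : 'I_d -> 'rV[R]_d.+1 -> R) (y : 'rV[R]_n) (that : 'rV[R]_d.+1) :
  (forall i t, m (xs i) t = u t + \sum_(k < d) p k t * xs i 0 k) ->
  u that = n%:R^-1 * \sum_(i < n) y 0 i ->
  (forall k, p k that = n%:R^-1 * \sum_(i < n) y 0 i * xs i 0 k) ->
  u (lse m xs y) = u that /\ forall k, p k (lse m xs y) = p k that.
Proof.
move=> hm hu hp.
have dec theta := sum_squares_decomposition theta hm hu hp.
have n0 : 0 < n%:R :> R by rewrite ltr0n.
have sq0 theta : 0 <= \sum_(k < d) (p k theta - p k that) ^+ 2.
  by rewrite sumr_ge0// => k _; exact: sqr_ge0.
have Pthat : [set theta | forall theta',
    sum_squares m xs y theta <= sum_squares m xs y theta'] that.
  move=> theta /=; rewrite [leRHS]dec lerDl mulr_ge0 ?(ltW n0)//.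
  by rewrite addr_ge0 ?sqr_ge0.
(* [that] is a minimizer, so the default value 0 is not the reason for the choice made by [lse].
   Comparing the chosen minimizer with [that] bounds a sum of squares by 0. *)
have /(_ that) := xgetI 0 Pthat.
rewrite -/(lse m xs y) dec gerDl pmulr_rle0// => h.
have s0 : (u (lse m xs y) - u that) ^+ 2 = 0.
  by apply/eqP; rewrite eq_le sqr_ge0 andbT (le_trans _ h)// lerDl.
split; first by apply/eqP; rewrite -subr_eq0 -sqrf_eq0 s0.
move=> k; move: h; rewrite s0 add0r => h.
have /eqP : \sum_(k < d) (p k (lse m xs y) - p k that) ^+ 2 = 0.
  by apply/eqP; rewrite eq_le h sq0.
rewrite psumr_eq0; last by move=> *; exact: sqr_ge0.
by move=> /allP/(_ k); rewrite mem_index_enum sqrf_eq0 subr_eq0 => /(_ isT)/eqP.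
Qed.

Definition design_coef (k : 'I_d) (i : 'I_n) : R := n%:R^-1 * xs i 0 k.

(** The empirical means are linear in the data: on the model values they return the coefficients at
    theta, and on z they give the added linear forms. *)
Lemma lse_perturbed (m : model R d) (u : 'rV[R]_d.+1 -> R)
    (p : 'I_d -> 'rV[R]_d.+1 -> R) (theta that : 'rV[R]_d.+1) (z : 'rV[R]_n) :
  (forall i t, m (xs i) t = u t + \sum_(k < d) p k t * xs i 0 k) ->
  u that = u theta + linear_form (fun=> n%:R^-1) z ->
  (forall k, p k that = p k theta + linear_form (design_coef k) z) ->
  let t := lse m xs (model_values m xs theta + z) in
  u t = u that /\ forall k, p k t = p k that.
Proof.
move=> hm hu hp.
have n0 : n%:R != 0 :> R by rewrite pnatr_eq0 -lt0n.
apply: (lse_orthogonal_design hm).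
  under eq_bigr do rewrite !mxE hm.
  rewrite !big_split/= sumr_const card_ord exchange_big/=.
  rewrite [X in _ + X + _]big1 ?addr0; last first.
    by move=> k _; rewrite -mulr_sumr design_sum mulr0.
  rewrite hu mulrDr -[u theta *+ n]mulr_natl mulKf//; congr (_ + _).
  by rewrite /linear_form mulr_sumr.
move=> k; under eq_bigr do rewrite !mxE hm !mulrDl mulr_suml.
rewrite !big_split/= -mulr_sumr design_sum mulr0 add0r exchange_big/=.
rewrite (bigD1 k)//= [X in _ + X + _]big1 ?addr0; last first.
  move=> l lk; under eq_bigr do rewrite -mulrA.
  by rewrite -mulr_sumr xs_orth (negbTE lk) !mulr0.
under [X in _ * (X + _)]eq_bigr do rewrite -mulrA.
rewrite -mulr_sumr xs_orth eqxx mulr1 hp mulrDr [p k theta * _]mulrC mulKf//.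
by congr (_ + _); rewrite mulr_sumr; apply: eq_bigr => i _; rewrite mulrA mulrAC.
Qed.

(** * The quadratic model and its linearization on the design *)

Context (alpha beta : 'I_d -> R).
Hypothesis alpha_neq0 : forall k, alpha k != 0.
Hypothesis xs_vert : forall i, vertices R d (xs i).
Local Notation f := (quad_model alpha beta).

Let intercept (t : 'rV[R]_d.+1) : R :=
  t 0 ord0 + \sum_(k < d) beta k * (t 0 (lift ord0 k) ^+ 2 / 2).

Lemma quad_model_design i t :
  f (xs i) t = intercept t + \sum_(k < d) (alpha k * t 0 (lift ord0 k)) * xs i 0 k.
Proof.
rewrite /quad_model /intercept addrAC; congr (_ + _ + _); apply: eq_bigr => k _.
by case: (xs_vert i k) => ->; rewrite ?sqrrN expr1n mulr1.
Qed.

Lemma quad_modelE x t :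
  f x t = intercept t + \sum_(k < d) (alpha k * t 0 (lift ord0 k)) * x 0 k
    + \sum_(k < d) beta k * (t 0 (lift ord0 k) ^+ 2 / 2) * (x 0 k ^+ 2 - 1).
Proof.
rewrite /quad_model /intercept.
under [X in _ = _ + X]eq_bigr do rewrite mulrBr mulr1.
by rewrite sumrB; ring.
Qed.

Lemma lse_quad theta z :
  let t := lse f xs (model_values f xs theta + z) in
  intercept t = intercept theta + linear_form (fun=> n%:R^-1) z /\
  forall k, t 0 (lift ord0 k) =
    theta 0 (lift ord0 k) + linear_form (design_coef k) z / alpha k.
Proof.
pose s k := theta 0 (lift ord0 k) + linear_form (design_coef k) z / alpha k.
(* The system is triangular: the entries of index k >= 1 are read off the slopes, then the intercept
   entry is corrected by the quadratic terms they create. *)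
pose that : 'rV[R]_d.+1 := \row_j
  if unlift ord0 j is Some k then s k
  else intercept theta + linear_form (fun=> n%:R^-1) z
       - \sum_(k < d) beta k * (s k ^+ 2 / 2).
have thatS k : that 0 (lift ord0 k) = s k by rewrite mxE liftK.
have that0 : intercept that = intercept theta + linear_form (fun=> n%:R^-1) z.
  rewrite /intercept mxE unlift_none; under [X in _ + X = _]eq_bigr do rewrite thatS.
  by rewrite subrK.
have [||] := @lse_perturbed f intercept (fun k t => alpha k * t 0 (lift ord0 k))
  theta that z quad_model_design.
- exact: that0.
- by move=> k; rewrite thatS mulrDr mulrCA divff ?mulr1.
move=> h0 h /=; rewrite h0; split=> [|k]; first exact: that0.
by apply: (mulfI (alpha_neq0 k)); rewrite h thatS.
Qed.

(** At z = 0 the estimate has the same coordinates as theta. This identifies both the linearization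
    point and the centre of g with the true parameter. *)
Lemma lse_quad_noise_free theta : lse f xs (model_values f xs theta) = theta.
Proof.
have linear_form0 u : linear_form u (0 : 'rV[R]_n) = 0.
  by rewrite /linear_form big1// => i _; rewrite mxE mulr0.
have := lse_quad theta 0; rewrite addr0 /= linear_form0 addr0 => -[h0 hS].
have {}hS k : lse f xs (model_values f xs theta) 0 (lift ord0 k) =
    theta 0 (lift ord0 k) by rewrite hS linear_form0 mul0r addr0.
apply/rowP => j; case: (unliftP ord0 j) => [k|] ->; first exact: hS.
move: h0; rewrite /intercept; under eq_bigr do rewrite hS.
exact: addIr.
Qed.

(** First-order coefficient of the prediction in the k-th empirical mean eta_k: with the intercept
    coordinate fixed, theta_k moves by eta_k / alpha_k. The matching second-order coefficient is
    [curvature]. *)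
Definition slope (x : 'rV[R]_d) (theta : 'rV[R]_d.+1) (k : 'I_d) : R :=
  x 0 k + beta k * theta 0 (lift ord0 k) * (x 0 k ^+ 2 - 1) / alpha k.

Definition prediction_coef x theta (i : 'I_n) : R :=
  n%:R^-1 + \sum_(k < d) slope x theta k * design_coef k i.

Definition curvature (x : 'rV[R]_d) (k : 'I_d) : R :=
  beta k * (x 0 k ^+ 2 - 1) / (2 * alpha k ^+ 2).

Lemma linear_form_prediction x theta z :
  linear_form (prediction_coef x theta) z = linear_form (fun=> n%:R^-1) z
    + \sum_(k < d) slope x theta k * linear_form (design_coef k) z.
Proof.
rewrite /linear_form/=; under eq_bigr do rewrite mulrDl mulr_suml.
rewrite big_split/= exchange_big/=; congr (_ + _); apply: eq_bigr => k _.
by rewrite mulr_sumr; apply: eq_bigr => i _; rewrite mulrA.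
Qed.

Lemma quad_prediction x theta z :
  f x (lse f xs (model_values f xs theta + z)) =
  f x theta + linear_form (prediction_coef x theta) z
  + \sum_(k < d) curvature x k * linear_form (design_coef k) z ^+ 2.
Proof.
have [h0 hS] := lse_quad theta z.
rewrite linear_form_prediction 2!quad_modelE h0.
under eq_bigr do rewrite hS.
under [X in _ + X = _]eq_bigr do rewrite hS.
have regroup (a b c a' b' c' : R) :
  a + b + c + (a' + b') + c' = a + a' + (b + c + b' + c') by ring.
rewrite regroup -[LHS]addrA; congr (_ + _).
rewrite -!big_split/=; apply: eq_bigr => k _.
rewrite /slope /curvature; field.
exact: alpha_neq0.
Qed.

Lemma perturbed_predictionE x theta z :
  perturbed_prediction f xs (model_values f xs theta) x z =
  f x theta + linear_form (prediction_coef x theta) z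
  + \sum_(k < d) curvature x k * linear_form (design_coef k) z ^+ 2.
Proof.
by rewrite /perturbed_prediction lse_quad_noise_free quad_prediction.
Qed.

Lemma gradient_quad x theta :
  gradient (f x) theta 0 ord0 = 1 /\
  forall k, gradient (f x) theta 0 (lift ord0 k) =
    alpha k * x 0 k + beta k * theta 0 (lift ord0 k) * x 0 k ^+ 2.
Proof.
split.
  rewrite mxE; apply: (@derive_quadratic _ _ _ _ _ 1 0) => h b hb.
  have b0 : b 0 ord0 = h + theta 0 ord0 by rewrite hb mxE !eqxx mulr1.
  have bS k : b 0 (lift ord0 k) = theta 0 (lift ord0 k).
    by rewrite hb mxE andbF mulr0 add0r.
  rewrite /quad_model b0; under eq_bigr do rewrite bS.
  under [X in _ + X = _]eq_bigr do rewrite bS.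
  by ring.
move=> k; rewrite mxE.
apply: (@derive_quadratic _ _ _ _ _ _ (beta k / 2 * x 0 k ^+ 2)) => h b hb.
have b0 : b 0 ord0 = theta 0 ord0 by rewrite hb mxE andbF mulr0 add0r.
have bS l : b 0 (lift ord0 l) = h * (l == k)%:R + theta 0 (lift ord0 l).
  by rewrite hb mxE eqxx (inj_eq lift_inj).
rewrite /quad_model b0; under eq_bigr do rewrite bS.
under [X in _ + X = _]eq_bigr do rewrite bS.
rewrite (bigD1 k)//= [X in _ + X = _](bigD1 k)//= eqxx.
under eq_bigr => l /negbTE -> do rewrite mulr0 add0r.
under [X in _ + (_ + X) = _]eq_bigr => l /negbTE -> do rewrite mulr0 add0r.
rewrite [in RHS](bigD1 k)//= [X in _ = _ + X + _ + _](bigD1 k)//=.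
by field.
Qed.

Lemma linearized_quad theta x t :
  linearized f theta x t = f x theta + (t 0 ord0 - theta 0 ord0)
    + \sum_(k < d) (alpha k * x 0 k + beta k * theta 0 (lift ord0 k) * x 0 k ^+ 2)
        * (t 0 (lift ord0 k) - theta 0 (lift ord0 k)).
Proof.
have [g0 gS] := gradient_quad x theta.
rewrite /linearized big_ord_recl g0 mul1r !mxE addrA; congr (_ + _).
by apply: eq_bigr => k _; rewrite gS !mxE.
Qed.

Lemma linearized_prediction x theta z :
  linearized f theta x
    (lse (linearized f theta) xs (model_values f xs theta + z)) =
  f x theta + linear_form (prediction_coef x theta) z.
Proof.
set L := linearized f theta.
have -> : model_values f xs theta = model_values L xs theta.
  apply/rowP => i; rewrite !mxE /L linearized_quad subrr addr0 big1 ?addr0//.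
  by move=> k _; rewrite subrr mulr0.
(* First-order expansion of [intercept] at theta. At the vertices the linearized model is again
   affine in x, with this [u] and unchanged slopes, so the same least-squares argument applies. *)
pose u (t : 'rV[R]_d.+1) := intercept theta + (t 0 ord0 - theta 0 ord0)
  + \sum_(k < d) beta k * theta 0 (lift ord0 k)
                 * (t 0 (lift ord0 k) - theta 0 (lift ord0 k)).
have hm i t : L (xs i) t = u t + \sum_(k < d) (alpha k * t 0 (lift ord0 k)) * xs i 0 k.
  rewrite /L linearized_quad quad_model_design /u.
  have regroup (a b c e : R) : a + b + c + e = a + c + (b + e) by ring.
  rewrite regroup -[RHS]addrA; congr (_ + _).
  rewrite -!big_split/=; apply: eq_bigr => k _.
  by case: (xs_vert i k) => ->; rewrite ?sqrrN expr1n; ring.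
pose s k := linear_form (design_coef k) z / alpha k.
pose that : 'rV[R]_d.+1 := theta + \row_j
  if unlift ord0 j is Some k then s k
  else linear_form (fun=> n%:R^-1) z
       - \sum_(k < d) beta k * theta 0 (lift ord0 k) * s k.
have thatS k : that 0 (lift ord0 k) = theta 0 (lift ord0 k) + s k.
  by rewrite !mxE liftK.
have that0 : that 0 ord0 = theta 0 ord0 + (linear_form (fun=> n%:R^-1) z
    - \sum_(k < d) beta k * theta 0 (lift ord0 k) * s k).
  by rewrite !mxE unlift_none.
have addrKl (a b : R) : a + b - a = b by rewrite addrAC subrr add0r.
have uthat : u that = u theta + linear_form (fun=> n%:R^-1) z.
  rewrite /u; under eq_bigr do rewrite thatS addrKl.
  under [X in _ = _ + X + _]eq_bigr do rewrite subrr mulr0.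
  by rewrite big1_eq that0; ring.
have [|] := lse_perturbed hm uthat.
  by move=> k; rewrite thatS mulrDr [alpha k * s k]mulrCA divff ?mulr1.
set t := lse _ _ _ => hu hS.
have {}hS k : t 0 (lift ord0 k) = theta 0 (lift ord0 k) + s k.
  by apply: (mulfI (alpha_neq0 k)); rewrite hS thatS.
rewrite /L linearized_quad.
have -> : t 0 ord0 - theta 0 ord0 = linear_form (fun=> n%:R^-1) z
    - \sum_(k < d) beta k * theta 0 (lift ord0 k) * s k.
  rewrite -[RHS](addrKl (theta 0 ord0)) -that0.
  have := hu; rewrite /u; under eq_bigr do rewrite hS -thatS.
  by move=> /addIr/addrI.
under [X in _ + X = _]eq_bigr do rewrite hS addrKl.
have regroup (a b c e : R) : a + (b - c) + e = a + (b + (e - c)) by ring.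
rewrite linear_form_prediction regroup; do 2 congr (_ + _).
rewrite -sumrB; apply: eq_bigr => k _.
rewrite /slope /s; field; exact: alpha_neq0.
Qed.

End LeastSquaresOrthogonalDesign.

(** * Linear forms in the noise *)

Section LinearForms.
Context (R : realType) (n : nat).
Implicit Types (u v : 'I_n -> R) (z : 'rV[R]_n).

Lemma linear_formD u z z' :
  linear_form u (z + z') = linear_form u z + linear_form u z'.
Proof.
by rewrite -big_split; apply: eq_bigr => i _; rewrite mxE mulrDr.
Qed.

Lemma linear_formZ u a z : linear_form u (a *: z) = a * linear_form u z.
Proof. by rewrite mulr_sumr; apply: eq_bigr => i _; rewrite mxE mulrCA. Qed.

Lemma linear_formN u z : linear_form u (- z) = - linear_form u z.
Proof. by rewrite -scaleN1r linear_formZ mulN1r. Qed.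

Lemma linear_form0 u : linear_form u 0 = 0.
Proof. by rewrite -(scale0r 0) linear_formZ mul0r. Qed.

Lemma linear_form_unit u i : linear_form u (unit_vec R i) = u i.
Proof.
rewrite /linear_form (bigD1 i)//= big1 ?addr0 ?mxE ?eqxx ?mulr1// => j ji.
by rewrite mxE (negbTE ji) mulr0.
Qed.

End LinearForms.

(** * Symmetric sums over pairs *)

Section PairSums.
Context (R : realType) (m : nat).
Implicit Types t s p q : 'I_m -> R.

(** The cubature rules sum over j < i, where double sums do not factor. A symmetric summand extends
    to the full square, where they do, at the price of the diagonal. *)
Lemma sum_pairs_symmetric (h : 'I_m -> 'I_m -> R) :
  (forall i j, h i j = h j i) ->
  2 * \sum_(i < m) \sum_(j < m | (j < i)%N) h i j =
  \sum_(i < m) \sum_(j < m) h i j - \sum_(i < m) h i i.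
Proof.
move=> hC.
have e i : \sum_(j < m) h i j = h i i +
    (\sum_(j < m | (j < i)%N) h i j + \sum_(j < m | (i < j)%N) h i j).
  rewrite (bigD1 i)//=; congr (_ + _).
  rewrite (bigID (fun j : 'I_m => (j < i)%N))/=.
  congr (_ + _); apply: eq_bigl => j; rewrite -val_eqE/=; case: ltngtP => //.
under [in RHS]eq_bigr do rewrite e.
rewrite !big_split/= [X in _ = _ + (_ + X) - _](_ : _ =
  \sum_(i < m) \sum_(j < m | (j < i)%N) h i j); first by ring.
rewrite (exchange_big_dep xpredT)//=; apply: eq_bigr => i _.
by apply: eq_bigr => j _; rewrite hC.
Qed.

Lemma sum_pairs1 : 2 * \sum_(i < m) \sum_(j < m | (j < i)%N) 1 = m%:R * (m%:R - 1) :> R.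
Proof.
rewrite sum_pairs_symmetric// !sumr_const !card_ord -mulr_natr; ring.
Qed.

Lemma sum_pairs_pm2 t s :
  \sum_(i < m) \sum_(j < m | (j < i)%N)
    ((t i + t j) * (s i + s j) + (t i - t j) * (s i - s j)) =
  2 * (m%:R - 1) * \sum_(i < m) t i * s i.
Proof.
apply: (mulfI (_ : 2 != 0)) => //.
rewrite sum_pairs_symmetric; last by move=> i j; ring.
have e i j : (t i + t j) * (s i + s j) + (t i - t j) * (s i - s j) =
  2 * (t i * s i) * 1 + 1 * (2 * (t j * s j)) by ring.
under eq_bigr do under eq_bigr do rewrite e.
under eq_bigr do rewrite big_split/=.
rewrite big_split/= -!big_distrlr/= -mulr_sumr sumr_const card_ord.
rewrite [X in _ - X](_ : _ = 4 * \sum_(i < m) t i * s i); first by ring.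
by rewrite mulr_sumr; apply: eq_bigr => i _; ring.
Qed.

(** Adding the product of differences cancels every term of odd degree in each index. The 4 in m - 4
    is the diagonal, where each of the four sums doubles. *)
Lemma sum_pairs_pm4 t s p q :
  \sum_(i < m) \sum_(j < m | (j < i)%N)
    ((t i + t j) * (s i + s j) * (p i + p j) * (q i + q j)
     + (t i - t j) * (s i - s j) * (p i - p j) * (q i - q j)) =
  2 * (m%:R - 4) * (\sum_(i < m) t i * s i * p i * q i)
  + 2 * ((\sum_(i < m) t i * s i) * (\sum_(i < m) p i * q i)
         + (\sum_(i < m) t i * p i) * (\sum_(i < m) s i * q i)
         + (\sum_(i < m) t i * q i) * (\sum_(i < m) s i * p i)).
Proof.
apply: (mulfI (_ : 2 != 0)) => //.
rewrite sum_pairs_symmetric; last by move=> i j; ring.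
rewrite [X in _ - X](_ : _ = 16 * \sum_(i < m) t i * s i * p i * q i); last first.
  by rewrite mulr_sumr; apply: eq_bigr => i _; ring.
have e i j : (t i + t j) * (s i + s j) * (p i + p j) * (q i + q j)
     + (t i - t j) * (s i - s j) * (p i - p j) * (q i - q j) =
  2 * (t i * s i * p i * q i * 1 + 1 * (t j * s j * p j * q j)
  + t i * s i * (p j * q j) + p i * q i * (t j * s j)
  + t i * p i * (s j * q j) + s i * q i * (t j * p j)
  + t i * q i * (s j * p j) + s i * p i * (t j * q j)) by ring.
under eq_bigr do under eq_bigr do rewrite e.
under eq_bigr do rewrite -mulr_sumr !big_split/=.
rewrite -mulr_sumr !big_split/= -!big_distrlr/= sumr_const card_ord.
by ring.
Qed.

Lemma sum_pairs_centered2 t s :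
  \sum_(i < m) t i = 0 -> \sum_(i < m) s i = 0 ->
  \sum_(i < m) \sum_(j < m | (j < i)%N) (t i + t j) * (s i + s j) =
  (m%:R - 2) * \sum_(i < m) t i * s i.
Proof.
move=> t0 s0; apply: (mulfI (_ : 2 != 0)) => //.
rewrite sum_pairs_symmetric; last by move=> i j; ring.
have e i j : (t i + t j) * (s i + s j) =
  t i * s i * 1 + 1 * (t j * s j) + t i * s j + s i * t j by ring.
under eq_bigr do under eq_bigr do rewrite e.
under eq_bigr do rewrite !big_split/=.
rewrite !big_split/= -!big_distrlr/= t0 s0 sumr_const card_ord.
rewrite [X in _ - X](_ : _ = 4 * \sum_(i < m) t i * s i); first by ring.
by rewrite mulr_sumr; apply: eq_bigr => i _; ring.
Qed.

(** With sums only, the terms of odd degree in i and j survive, but each contains a factor summing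
    to zero. The diagonal, 16 times the quartic sum, then weighs twice as much relative to the rest
    as in [sum_pairs_pm4]: hence m - 8. *)
Lemma sum_pairs_centered4 t s p q :
  \sum_(i < m) t i = 0 -> \sum_(i < m) s i = 0 ->
  \sum_(i < m) p i = 0 -> \sum_(i < m) q i = 0 ->
  \sum_(i < m) \sum_(j < m | (j < i)%N)
    (t i + t j) * (s i + s j) * (p i + p j) * (q i + q j) =
  (m%:R - 8) * (\sum_(i < m) t i * s i * p i * q i)
  + ((\sum_(i < m) t i * s i) * (\sum_(i < m) p i * q i)
     + (\sum_(i < m) t i * p i) * (\sum_(i < m) s i * q i)
     + (\sum_(i < m) t i * q i) * (\sum_(i < m) s i * p i)).
Proof.
move=> t0 s0 p0 q0; apply: (mulfI (_ : 2 != 0)) => //.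
rewrite sum_pairs_symmetric; last by move=> i j; ring.
have e i j : (t i + t j) * (s i + s j) * (p i + p j) * (q i + q j) =
  t i * s i * p i * q i * 1 + 1 * (t j * s j * p j * q j)
  + t i * s i * (p j * q j) + p i * q i * (t j * s j)
  + t i * p i * (s j * q j) + s i * q i * (t j * p j)
  + t i * q i * (s j * p j) + s i * p i * (t j * q j)
  + t i * (s j * p j * q j) + s i * (t j * p j * q j)
  + p i * (t j * s j * q j) + q i * (t j * s j * p j)
  + s i * p i * q i * t j + t i * p i * q i * s j
  + t i * s i * q i * p j + t i * s i * p i * q j by ring.
under eq_bigr do under eq_bigr do rewrite e.
under eq_bigr do rewrite !big_split/=.
rewrite !big_split/= -!big_distrlr/= t0 s0 p0 q0 sumr_const card_ord.
rewrite [X in _ - X](_ : _ = 16 * \sum_(i < m) t i * s i * p i * q i); first by ring.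
by rewrite mulr_sumr; apply: eq_bigr => i _; ring.
Qed.

End PairSums.

(** * Variance of a quadratic polynomial *)

(** Closure of the domain is bundled with linearity: for expectations [D] is integrability, for
    cubature rules it is [setT]. *)
Definition linear_functional_on (R : realType) (V : Type) (D : set (V -> R))
    (E : (V -> R) -> R) : Prop :=
  forall a g h, D g -> D h ->
    D (fun v => a * g v + h v) /\ E (fun v => a * g v + h v) = a * E g + E h.

Definition dotp (R : realType) (n : nat) (u v : 'I_n -> R) : R :=
  \sum_(i < n) u i * v i.

(** Moments of orders 0 to 4 of the linear forms in [Z], which is the identity for a cubature rule
    and the noise vector for the Gaussian law. Order four is left as a parameter, being the only one
    in which the methods may differ. *)
Definition linear_form_moments (R : realType) (V : Type) (n : nat)
    (D : set (V -> R)) (E : (V -> R) -> R) (Z : V -> 'rV[R]_n) (s : R)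
    (W : ('I_n -> R) -> ('I_n -> R) -> ('I_n -> R) -> ('I_n -> R) -> R) : Prop :=
  let l u v := linear_form u (Z v) in
  [/\ D (fun=> 1) /\ E (fun=> 1) = 1,
      forall t, D (l t) /\ E (l t) = 0,
      forall t u, D (fun v => l t v * l u v) /\
        E (fun v => l t v * l u v) = s * dotp t u,
      forall t u p, D (fun v => l t v * l u v * l p v) /\
        E (fun v => l t v * l u v * l p v) = 0 &
      forall t u p q, D (fun v => l t v * l u v * l p v * l q v) /\
        E (fun v => l t v * l u v * l p v * l q v) = W t u p q].

Section QuadraticVariance.
Context (R : realType) (V : Type) (D : set (V -> R)) (E : (V -> R) -> R).
Hypothesis E_linear : linear_functional_on D E.
Hypothesis D1 : D (fun=> 1).

Let Dlin a g h (Dg : D g) (Dh : D h) := (E_linear a Dg Dh).1.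
Let Elin a g h (Dg : D g) (Dh : D h) := (E_linear a Dg Dh).2.

Lemma functional0 : D (fun=> 0) /\ E (fun=> 0) = 0.
Proof.
have e : (fun v : V => -1 * 1 + 1) = (fun=> 0) :> (V -> R) by apply/funext => v; ring.
have := E_linear (-1) D1 D1; rewrite e => -[h1 ->]; split=> //; ring.
Qed.

Lemma functional_sum (I : finType) (a : I -> R) (F : I -> V -> R) :
  (forall i, D (F i)) ->
  D (fun v => \sum_i a i * F i v) /\
  E (fun v => \sum_i a i * F i v) = \sum_i a i * E (F i).
Proof.
move=> DF; elim: (index_enum I) => [|i r [IHD IHE]].
  under eq_fun do rewrite big_nil.
  by rewrite big_nil; exact: functional0.
under eq_fun do rewrite big_cons.
rewrite big_cons; split; first exact: Dlin.
by rewrite (Elin _ (DF i)) ?IHE.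
Qed.

(** The product of the linear and quadratic parts has third-order moments only, so it contributes
    nothing. The squared mean of the quadratic part spreads over the pairs (k, l) as (s r)^2, all
    v_k having the same squared norm r. *)
Lemma quadratic_variance (n d : nat) (Z : V -> 'rV[R]_n) (s : R) W
    (c : R) (w : 'I_n -> R) (v : 'I_d -> 'I_n -> R) (gamma : 'I_d -> R) (r : R) :
  linear_form_moments D E Z s W ->
  (forall k, dotp (v k) (v k) = r) ->
  let g x := c + linear_form w (Z x)
    + \sum_(k < d) gamma k * linear_form (v k) (Z x) ^+ 2 in
  let h x := (g x - E g) ^+ 2 in
  [/\ D g, D h & E h = s * dotp w w + \sum_(k < d) \sum_(l < d)
    gamma k * gamma l * (W (v k) (v k) (v l) (v l) - (s * r) ^+ 2)].
Proof.
move=> [[_ E1] m1 m2 m3 m4] vr /=.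
pose L x := linear_form w (Z x).
pose eta k x := linear_form (v k) (Z x).
pose eta2 k x := eta k x * eta k x.
have Deta2 k : D (eta2 k) by exact: (m2 _ _).1.
have Eeta2 k : E (eta2 k) = s * r by rewrite (m2 _ _).2 vr.
have [DS ES] := functional_sum gamma Deta2.
set S := (fun x => \sum_k gamma k * eta2 k x) in DS ES.
have DL : D L by exact: (m1 _).1.
have EL : E L = 0 by exact: (m1 _).2.
have -> : (fun x => c + linear_form w (Z x) +
    \sum_(k < d) gamma k * linear_form (v k) (Z x) ^+ 2) =
    (fun x => c * 1 + (1 * L x + S x)).
  by apply/funext => x; rewrite mulr1 mul1r -addrA.
have DLS := Dlin 1 DL DS; have Dg := Dlin c D1 DLS.
pose G := \sum_(k < d) gamma k * E (eta2 k).
have -> : E (fun x => c * 1 + (1 * L x + S x)) = c + G.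
  by rewrite (Elin _ D1 DLS) (Elin _ DL DS) E1 EL ES -/G; ring.
have GE : G = s * r * \sum_k gamma k.
  by rewrite mulr_sumr; apply: eq_bigr => k _; rewrite Eeta2 mulrC.
have Leta2 k : D (fun x => L x * eta2 k x) /\ E (fun x => L x * eta2 k x) = 0.
  rewrite (_ : (fun x => _) = fun x => L x * eta k x * eta k x).
    exact: m3.
  by apply/funext => x; rewrite mulrA.
have eta4 (kl : 'I_d * 'I_d) :
    D (fun x => eta2 kl.1 x * eta2 kl.2 x) /\
    E (fun x => eta2 kl.1 x * eta2 kl.2 x) =
      W (v kl.1) (v kl.1) (v kl.2) (v kl.2).
  rewrite (_ : (fun x => _) =
    fun x => eta kl.1 x * eta kl.1 x * eta kl.2 x * eta kl.2 x).
    exact: m4.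
  by apply/funext => x; rewrite mulrA.
have [D3 E3] := functional_sum (fun k => 2 * gamma k) (fun k => (Leta2 k).1).
have [D4 E4] := functional_sum (fun kl => gamma kl.1 * gamma kl.2)
  (fun kl => (eta4 kl).1).
set S3 := (fun x => \sum_k _) in D3 E3.
set S4 := (fun x => \sum_kl _) in D4 E4.
have {}E3 : E S3 = 0 by rewrite E3 big1// => k _; rewrite (Leta2 k).2 mulr0.
have {}E4 : E S4 = \sum_kl gamma kl.1 * gamma kl.2 *
    W (v kl.1) (v kl.1) (v kl.2) (v kl.2).
  by rewrite E4; apply: eq_bigr => kl _; rewrite (eta4 kl).2.
have [DLL ELL] := m2 w w.
(* Expansion of (L + S - G)^2, nested as repeated a * g + h, the only shape on which linearity of
   [E] and closure of [D] are available. *)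
have -> : (fun x => (c + linear_form w (Z x) +
    \sum_(k < d) gamma k * linear_form (v k) (Z x) ^+ 2 - (c + G)) ^+ 2) =
  (fun x => 1 * (L x * L x) + (1 * S3 x + (1 * S4 x +
     ((- (2 * G)) * L x + ((- (2 * G)) * S x + (G ^+ 2 * 1 + 0)))))).
  apply/funext => x; rewrite -/(L x) -/(S x).
  have -> : S3 x = 2 * (L x * S x).
    by rewrite !mulr_sumr; apply: eq_bigr => k _; ring.
  have -> : S4 x = S x * S x.
    rewrite /S4 /S big_distrlr/= pair_big/=; apply: eq_bigr => kl _; ring.
  by ring.
have [D0 E0] := functional0.
have H1 := Dlin (G ^+ 2) D1 D0; have H2 := Dlin (- (2 * G)) DS H1.
have H3 := Dlin (- (2 * G)) DL H2; have H4 := Dlin 1 D4 H3.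
have H5 := Dlin 1 D3 H4; have H6 := Dlin 1 DLL H5.
split=> //.
rewrite (Elin _ DLL H5) (Elin _ D3 H4) (Elin _ D4 H3) (Elin _ DL H2).
rewrite (Elin _ DS H1) (Elin _ D1 D0) E0 E1 EL E3 ES -/G ELL E4.
rewrite pair_big/= mul1r; congr (_ + _).
rewrite [RHS](_ : _ = \sum_kl gamma kl.1 * gamma kl.2 *
    W (v kl.1) (v kl.1) (v kl.2) (v kl.2) - G ^+ 2); first by ring.
have -> : G ^+ 2 = \sum_kl gamma kl.1 * gamma kl.2 * (s * r) ^+ 2.
  rewrite GE exprMn [X in _ * X]expr2 big_distrlr/= pair_big/= mulr_sumr.
  by apply: eq_bigr => kl _; rewrite mulrC.
by rewrite -sumrB; apply: eq_bigr => kl _; ring.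
Qed.

End QuadraticVariance.

(** * Moments of the cubature rules *)

(** Isserlis' formula for covariance s times the identity: the sum over the three pairings of four
    forms. *)
Definition gaussian_tensor (R : realType) (n : nat) (s : R)
    (t u p q : 'I_n -> R) : R :=
  s ^+ 2 * (dotp t u * dotp p q + dotp t p * dotp u q + dotp t q * dotp u p).

Section SymmetricRules.
Context (R : realType) (n : nat).
Implicit Types (phi : 'rV[R]_n -> R) (sigma : R).

Lemma sumr_linear (I : finType) (P : pred I) (a : R) (F G H : I -> R) :
  (forall i, P i -> F i = a * G i + H i) ->
  \sum_(i | P i) F i = a * \sum_(i | P i) G i + \sum_(i | P i) H i.
Proof.
by move=> e; rewrite mulr_sumr -big_split; exact: eq_bigr.
Qed.

Lemma linear_Q_SP kappa sigma :
  linear_functional_on setT (@Q_SP R n kappa sigma).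
Proof.
move=> a g h _ _; split=> //; rewrite /Q_SP; cbv zeta.
have regroup (w0 w1 x y X Y : R) : a * (w0 * x + w1 * X) + (w0 * y + w1 * Y) =
  w0 * (a * x + y) + w1 * (a * X + Y) by ring.
rewrite regroup; congr (_ + _ * _).
by apply: sumr_linear => i _; ring.
Qed.

Let regroup3 (a w0 w1 w2 x y X Y Z T : R) :
  a * (w0 * x + w1 * X + w2 * Z) + (w0 * y + w1 * Y + w2 * T) =
  w0 * (a * x + y) + w1 * (a * X + Y) + w2 * (a * Z + T).
Proof. by ring. Qed.

Lemma linear_Q_MS sigma : linear_functional_on setT (@Q_MS R n sigma).
Proof.
move=> a g h _ _; split=> //; rewrite /Q_MS; cbv zeta.
rewrite regroup3; congr (_ + _ * _ + _ * _).
  by apply: sumr_linear => i _; ring.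
by apply: sumr_linear => i _; apply: sumr_linear => j _; ring.
Qed.

Lemma linear_Q_LD sigma : linear_functional_on setT (@Q_LD R n sigma).
Proof.
move=> a g h _ _; split=> //; rewrite /Q_LD; cbv zeta.
rewrite regroup3; congr (_ + _ * _ + _ * _).
  by apply: sumr_linear => i _; ring.
by apply: sumr_linear => i _; apply: sumr_linear => j _; ring.
Qed.

Lemma Q_SP_odd kappa sigma phi :
  (forall z, phi (- z) = - phi z) -> Q_SP kappa sigma phi = 0.
Proof.
move=> hphi.
have phi0 : phi 0 = 0 by apply/eqP; rewrite -eqNr -hphi oppr0.
rewrite /Q_SP phi0 mulr0 add0r big1 ?mulr0// => i _.
by rewrite hphi subrr.
Qed.

Lemma Q_MS_odd sigma phi : (forall z, phi (- z) = - phi z) -> Q_MS sigma phi = 0.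
Proof.
move=> hphi.
have phi0 : phi 0 = 0 by apply/eqP; rewrite -eqNr -hphi oppr0.
rewrite /Q_MS phi0 mulr0 add0r big1 ?mulr0 ?add0r; last first.
  by move=> i _; rewrite hphi subrr.
rewrite big1 ?mulr0// => i _; rewrite big1// => j _.
by rewrite !hphi subrr add0r subrr.
Qed.

Lemma Q_LD_odd sigma phi : (forall z, phi (- z) = - phi z) -> Q_LD sigma phi = 0.
Proof.
move=> hphi.
have phi0 : phi 0 = 0 by apply/eqP; rewrite -eqNr -hphi oppr0.
rewrite /Q_LD phi0 mulr0 add0r big1 ?mulr0 ?add0r; last first.
  by move=> i _; rewrite hphi subrr.
rewrite big1 ?mulr0// => i _; rewrite big1// => j _.
by rewrite hphi subrr.
Qed.

(** Each sigma point lies on one axis, so distinct coordinates never interact and the fourth moments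
    are diagonal, with weight 2 w1 delta^4 = (n + kappa) sigma^4. *)
Lemma Q_SP_moments kappa sigma : 0 < n%:R + kappa ->
  linear_form_moments setT (@Q_SP R n kappa sigma) id (sigma ^+ 2)
    (fun t u p q => (n%:R + kappa) * sigma ^+ 4 * \sum_(i < n) t i * u i * p i * q i).
Proof.
move=> nk; have nk0 : n%:R + kappa != 0 by rewrite gt_eqF.
have d2 : Num.sqrt (n%:R + kappa) ^+ 2 = n%:R + kappa by rewrite sqr_sqrtr// ltW.
split.
- split=> //; rewrite /Q_SP sumr_const card_ord -[_ *+ n]mulr_natl; field.
  exact: nk0.
- by move=> t; split=> //; apply: Q_SP_odd => z; rewrite linear_formN.
- move=> t u; split=> //; rewrite /Q_SP !linear_form0 mul0r mulr0 add0r.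
  under eq_bigr do rewrite !linear_formN !linear_formZ !linear_form_unit.
  rewrite (_ : \sum_i _ = 2 * (n%:R + kappa) * sigma ^+ 2 * dotp t u).
    by field.
  by rewrite /dotp mulr_sumr; apply: eq_bigr => i _; rewrite -[in RHS]d2; ring.
- move=> t u p; split=> //; apply: Q_SP_odd => z.
  by rewrite !linear_formN; ring.
- move=> t u p q; split=> //; rewrite /Q_SP !linear_form0 !mul0r mulr0 add0r.
  under eq_bigr do rewrite !linear_formN !linear_formZ !linear_form_unit.
  rewrite (_ : \sum_i _ = 2 * (n%:R + kappa) ^+ 2 * sigma ^+ 4 *
      \sum_(i < n) t i * u i * p i * q i); first by field.
  by rewrite mulr_sumr; apply: eq_bigr => i _; rewrite -[in RHS]d2; ring.
Qed.

(** At order four the axis points contribute (4 - n) sigma^4 times the diagonal quartic sum. The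
    pairs contribute its opposite plus the three Gaussian pairings. *)
Lemma Q_MS_moments sigma : 0 < sigma ->
  linear_form_moments setT (@Q_MS R n sigma) id (sigma ^+ 2)
    (gaussian_tensor (sigma ^+ 2)).
Proof.
move=> s_gt0; have s0 : sigma != 0 by rewrite gt_eqF.
have d2 : Num.sqrt (3 * sigma ^+ 4 / sigma ^+ 2) ^+ 2 = 3 * sigma ^+ 2.
  rewrite sqr_sqrtr; last by rewrite divr_ge0 ?mulr_ge0 ?exprn_ge0 ?(ltW s_gt0).
  by field.
split.
- split=> //; rewrite /Q_MS.
  have := sum_pairs1 R n; set S := (X in 2 * X = _) => hS.
  rewrite [X in _ + _ + _ * X](_ : _ = 4 * S); last first.
    rewrite /S mulr_sumr; apply: eq_bigr => i _; rewrite mulr_sumr.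
    by apply: eq_bigr => j _; ring.
  rewrite (_ : 4 * S = 2 * (2 * S)); last by ring.
  rewrite hS sumr_const card_ord -[(1 + 1) *+ n]mulr_natl; field.
  exact: s0.
- by move=> t; split=> //; apply: Q_MS_odd => z; rewrite linear_formN.
- move=> t u; split=> //; rewrite /Q_MS !linear_form0 mul0r mulr0 add0r.
  under eq_bigr do rewrite !linear_formN !linear_formZ !linear_form_unit.
  rewrite (_ : \sum_i _ = 6 * sigma ^+ 2 * dotp t u); last first.
    by rewrite /dotp mulr_sumr; apply: eq_bigr => i _; ring: d2.
  rewrite [X in _ + _ * X](_ : _ = 6 * sigma ^+ 2 * (2 * (n%:R - 1) * dotp t u)).
    by field.
  rewrite -sum_pairs_pm2 mulr_sumr; apply: eq_bigr => i _.
  rewrite mulr_sumr; apply: eq_bigr => j _.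
  rewrite !linear_formN !linear_formZ !linear_formD !linear_formN !linear_form_unit.
  ring: d2.
- move=> t u p; split=> //; apply: Q_MS_odd => z.
  by rewrite !linear_formN; ring.
- move=> t u p q; split=> //; rewrite /Q_MS !linear_form0 !mul0r mulr0 add0r.
  under eq_bigr do rewrite !linear_formN !linear_formZ !linear_form_unit.
  set S4 := \sum_(i < n) t i * u i * p i * q i.
  rewrite (_ : \sum_i _ = 18 * sigma ^+ 4 * S4); last first.
    by rewrite mulr_sumr; apply: eq_bigr => i _; ring: d2.
  rewrite [X in _ + _ * X](_ : _ = 18 * sigma ^+ 4 * (2 * (n%:R - 4) * S4
    + 2 * (dotp t u * dotp p q + dotp t p * dotp u q + dotp t q * dotp u p))).
    by rewrite /gaussian_tensor; field.
  rewrite -sum_pairs_pm4 mulr_sumr; apply: eq_bigr => i _.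
  rewrite mulr_sumr; apply: eq_bigr => j _.
  rewrite !linear_formN !linear_formZ !linear_formD !linear_formN !linear_form_unit.
  ring: d2.
Qed.

End SymmetricRules.

(** * The Lu--Darmofal simplex *)

Section LuDarmofal.
Context (R : realType) (n : nat).
Hypothesis n_gt1 : (1 < n)%N.
Implicit Types (t u p q : 'I_n -> R).

(** With k counted from 0 this is n - k' + 1. It is also the number of vertices of index i > k,
    those whose k-th entry is [- scale k]. *)
Let codim (k : 'I_n) : R := n%:R - k%:R.
Let scale (k : 'I_n) : R :=
  Num.sqrt ((n%:R + 1) / (n%:R * codim k * (codim k + 1))).

Let codim_gt0 k : 0 < codim k.
Proof. by rewrite subr_gt0 ltr_nat. Qed.

Let n_gt0 : 0 < n%:R :> R.
Proof. by rewrite ltr0n (ltn_trans _ n_gt1). Qed.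

Let scale_sq k : scale k ^+ 2 = (n%:R + 1) / (n%:R * codim k * (codim k + 1)).
Proof.
have c_ge0 := ltW (codim_gt0 k); have n_ge0 := ltW n_gt0.
rewrite sqr_sqrtr//; apply: divr_ge0; first exact: addr_ge0.
by apply: mulr_ge0; [exact: mulr_ge0|exact: addr_ge0].
Qed.

(** Expressing the diagonal entry as [codim k] times the common scale makes the balance of each
    column visible: one entry compensates the [codim k] equal entries of later vertices. *)
Lemma LD_aE (i : 'I_n.+1) (k : 'I_n) : LD_a R i 0 k =
  if (k < i)%N then - scale k
  else if k == i :> nat then codim k * scale k else 0.
Proof.
rewrite mxE; case: ifP => _.
  congr (- Num.sqrt (_ / _)); rewrite /codim -natr1; ring.
case: eqP => // ki; rewrite /scale /codim ki.
set r := n%:R - i%:R.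
have r_gt0 : 0 < r by rewrite /r -ki codim_gt0.
rewrite -[X in _ = X * _](ger0_norm (ltW r_gt0)) -sqrtr_sqr -sqrtrM ?sqr_ge0//.
congr Num.sqrt.
have -> : n%:R - i.+1%:R + 1 = r by rewrite /r -natr1; ring.
have -> : n%:R - i.+1%:R + 2 = r + 1 by rewrite /r -natr1; ring.
field; rewrite !gt_eqF//; exact: addr_gt0.
Qed.

Lemma sum_LD_pattern (k : 'I_n) (a b : R) :
  \sum_(i < n.+1) (if (k < i)%N then a else if k == i :> nat then b else 0) =
  b + codim k * a.
Proof.
pose F i := if (k < i)%N then a else if k == i :> nat then b else 0.
rewrite -(big_mkord xpredT F) (@big_cat_nat _ _ _ k)//=; last by rewrite leqW// ltnW.
rewrite big_nat_cond big1 ?add0r; last first.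
  by move=> i; rewrite andbT /F; case: ltngtP.
rewrite big_nat_recl ?ltnS; last exact: ltnW.
rewrite {1}/F ltnn eqxx; congr (_ + _).
under eq_big_nat => i /andP[ki _] do rewrite /F ltnS ki.
by rewrite sumr_const_nat -[_ *+ _]mulr_natl natrB// ltnW.
Qed.

Lemma sum_LD_a k : \sum_(i < n.+1) LD_a R i 0 k = 0.
Proof.
under eq_bigr do rewrite LD_aE.
by rewrite sum_LD_pattern; ring.
Qed.

Lemma sum_LD_a_sq k : \sum_(i < n.+1) LD_a R i 0 k ^+ 2 = (n%:R + 1) / n%:R.
Proof.
have e (i : 'I_n.+1) : LD_a R i 0 k ^+ 2 =
    if (k < i)%N then scale k ^+ 2
    else if k == i :> nat then codim k ^+ 2 * scale k ^+ 2 else 0.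
  rewrite LD_aE; case: ifP => _; first by rewrite sqrrN.
  by case: ifP => _; rewrite ?exprMn ?expr0n.
under eq_bigr do rewrite e.
rewrite sum_LD_pattern scale_sq; field.
have c_gt0 := codim_gt0 k; have c1_gt0 : 0 < codim k + 1 by exact: addr_gt0.
by rewrite (gt_eqF c_gt0) (gt_eqF c1_gt0) (gt_eqF n_gt0).
Qed.

(** Wherever column l is nonzero, i >= l > k, so column k has the constant value [- scale k] there.
    The inner product is thus a multiple of the zero sum of column l. *)
Lemma sum_LD_a_orth (k l : 'I_n) : (k < l)%N ->
  \sum_(i < n.+1) LD_a R i 0 k * LD_a R i 0 l = 0.
Proof.
move=> kl; have e (i : 'I_n.+1) :
    LD_a R i 0 k * LD_a R i 0 l = - scale k * LD_a R i 0 l.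
  case: (leqP i k) => ik; last by rewrite [LD_a R i 0 k]LD_aE ik.
  have il := leq_ltn_trans ik kl.
  by rewrite [LD_a R i 0 l]LD_aE ltnNge (ltnW il)/= gtn_eqF// !mulr0.
under eq_bigr do rewrite e.
by rewrite -mulr_sumr sum_LD_a mulr0.
Qed.

Lemma LD_a_tight_frame k l :
  \sum_(i < n.+1) LD_a R i 0 k * LD_a R i 0 l = (n%:R + 1) / n%:R * (k == l)%:R.
Proof.
case: (ltngtP k l) => [kl|lk|/val_inj->].
- by rewrite sum_LD_a_orth// -val_eqE/= ltn_eqF// mulr0.
- under eq_bigr do rewrite mulrC.
  by rewrite sum_LD_a_orth// -val_eqE/= gtn_eqF// mulr0.
- by rewrite eqxx mulr1 -(sum_LD_a_sq l); apply: eq_bigr.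
Qed.

Let A t (i : 'I_n.+1) : R := linear_form t (LD_a R i).

Lemma sum_linear_form_LD_a t : \sum_i A t i = 0.
Proof.
rewrite /A /linear_form exchange_big/= big1// => k _.
by rewrite -mulr_sumr sum_LD_a mulr0.
Qed.

Lemma linear_form_tight_frame t u :
  \sum_i A t i * A u i = (n%:R + 1) / n%:R * dotp t u.
Proof.
rewrite /A /linear_form; under eq_bigr do rewrite big_distrlr/=.
rewrite exchange_big/= /dotp mulr_sumr; apply: eq_bigr => k _.
rewrite exchange_big/= (bigD1 k)//= [X in _ + X]big1 ?addr0.
  under eq_bigr do rewrite mulrACA.
  by rewrite -mulr_sumr LD_a_tight_frame eqxx mulr1 mulrC.
move=> l lk; under eq_bigr do rewrite mulrACA.
by rewrite -mulr_sumr LD_a_tight_frame eq_sym (negbTE lk) !mulr0.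
Qed.

(** The factor 7 - n of w1 cancels the quartic coefficient (n + 1) - 8 of the pair sum. The
    tight-frame constant ((n + 1) / n)^2 cancels the remaining weight n^2 / (n + 1)^2 of the
    Gaussian pairings. *)
Lemma Q_LD_moments (sigma : R) : 0 < sigma ->
  linear_form_moments setT (@Q_LD R n sigma) id (sigma ^+ 2)
    (gaussian_tensor (sigma ^+ 2)).
Proof.
move=> s_gt0.
have n0 : n%:R != 0 :> R by rewrite gt_eqF.
have n1 : n%:R - 1 != 0 :> R.
  by rewrite subr_eq0 pnatr_eq1 gtn_eqF.
have n1p : n%:R + 1 != 0 :> R by rewrite gt_eqF// addr_gt0.
have n2p : n%:R + 2 != 0 :> R by rewrite gt_eqF// addr_gt0.
have d2 : Num.sqrt (n%:R + 2) ^+ 2 = n%:R + 2 :> R.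
  by rewrite sqr_sqrtr// addr_ge0// ltW.
have e2 : Num.sqrt (n%:R / (2 * (n%:R - 1))) ^+ 2 =
    n%:R / (2 * (n%:R - 1)) :> R.
  rewrite sqr_sqrtr//; apply: divr_ge0; first exact: ltW.
  by rewrite mulr_ge0// subr_ge0 ler1n ltnW.
have n1E : n.+1%:R = n%:R + 1 :> R by rewrite natr1.
split.
- split=> //; rewrite /Q_LD.
  have := sum_pairs1 R n.+1; set S := (X in 2 * X = _) => hS.
  rewrite [X in _ + _ + _ * X](_ : _ = 2 * S); last first.
    rewrite /S mulr_sumr; apply: eq_bigr => i _; rewrite mulr_sumr.
    by apply: eq_bigr => j _; ring.
  rewrite hS sumr_const card_ord -[(1 + 1) *+ n.+1]mulr_natl n1E; field.
  by rewrite n1p n2p.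
- by move=> t; split=> //; apply: Q_LD_odd => z; rewrite linear_formN.
- move=> t u; split=> //; rewrite /Q_LD !linear_form0 mul0r mulr0 add0r.
  under eq_bigr do rewrite !linear_formN !linear_formZ.
  rewrite (_ : \sum_i _ = 2 * (n%:R + 2) * sigma ^+ 2 *
      ((n%:R + 1) / n%:R * dotp t u)); last first.
    rewrite -linear_form_tight_frame mulr_sumr; apply: eq_bigr => i _.
    by rewrite /A; ring: d2.
  rewrite [X in _ + _ * X](_ : _ = 2 * (n%:R + 2) * sigma ^+ 2
      * (n%:R / (2 * (n%:R - 1)))
      * ((n.+1%:R - 2) * ((n%:R + 1) / n%:R * dotp t u))).
    by rewrite n1E; field; rewrite ?n0 ?n1 ?n1p ?n2p.
  rewrite -linear_form_tight_frame -sum_pairs_centered2 ?sum_linear_form_LD_a//.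
  rewrite mulr_sumr; apply: eq_bigr => i _.
  rewrite mulr_sumr; apply: eq_bigr => j _.
  rewrite !linear_formN /LD_b !linear_formZ !linear_formD -[in RHS]e2 -[in RHS]d2 /A.
  ring.
- move=> t u p; split=> //; apply: Q_LD_odd => z.
  by rewrite !linear_formN; ring.
- move=> t u p q; split=> //; rewrite /Q_LD !linear_form0 !mul0r mulr0 add0r.
  under eq_bigr do rewrite !linear_formN !linear_formZ.
  set S4 := \sum_i A t i * A u i * A p i * A q i.
  rewrite (_ : \sum_i _ = 2 * (n%:R + 2) ^+ 2 * sigma ^+ 4 * S4); last first.
    by rewrite mulr_sumr; apply: eq_bigr => i _; rewrite /A; ring: d2.
  pose c : R := (n%:R + 1) / n%:R.
  rewrite [X in _ + _ * X](_ : _ = 2 * (n%:R + 2) ^+ 2 * sigma ^+ 4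
      * (n%:R / (2 * (n%:R - 1))) ^+ 2
      * ((n.+1%:R - 8) * S4 + (c * dotp t u * (c * dotp p q)
          + c * dotp t p * (c * dotp u q) + c * dotp t q * (c * dotp u p)))).
    by rewrite n1E /c /gaussian_tensor; field; rewrite ?n0 ?n1 ?n1p ?n2p.
  rewrite -!linear_form_tight_frame.
  rewrite -sum_pairs_centered4 ?sum_linear_form_LD_a//.
  rewrite mulr_sumr; apply: eq_bigr => i _.
  rewrite mulr_sumr; apply: eq_bigr => j _.
  rewrite !linear_formN /LD_b !linear_formZ !linear_formD -[in RHS]e2 -[in RHS]d2 /A.
  ring.
Qed.

End LuDarmofal.

(** * Moments of independent normal variables *)

Section Density.
Import HBNNSimple.
Context d d' (T : measurableType d) (T' : measurableType d') (R : realType)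
  (mu : {measure set T -> \bar R}) (nu : {measure set T' -> \bar R}).
Local Open Scope ereal_scope.

(** Simple functions reduce to the hypothesis on sets, and monotone convergence does the rest.
    Keeping both [X] and [W] serves two uses: a law with a Lebesgue density, and a law weighted by
    the other factors of a product. *)
Lemma ge0_integral_density (X : T -> T') (W : T -> R) (h : T' -> \bar R) :
  measurable_fun setT X -> measurable_fun setT W -> (forall t, 0 <= W t)%R ->
  (forall A, measurable A -> nu A = \int[mu]_(t in X @^-1` A) (W t)%:E) ->
  measurable_fun setT h -> (forall y, 0 <= h y) ->
  \int[nu]_y h y = \int[mu]_t (h (X t) * (W t)%:E).
Proof.
move=> mX mW' W0' nuE mh h0.
have mW : measurable_fun setT (EFin \o W) by exact/measurable_EFinP.
have W0 t : 0 <= (W t)%:E by rewrite lee_fin.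
pose g := nnsfun_approx measurableT mh.
have cvg_g y : (g n y)%:E @[n --> \oo] --> h y by exact: cvg_nnsfun_approx.
have nd_g y : {homo (fun n => (g n y)%:E) : m n / (m <= n)%N >-> m <= n}.
  by move=> m n mn; rewrite lee_fin; exact/lefP/nd_nnsfun_approx.
have simple (k : {nnsfun T' >-> R}) :
    \int[nu]_y (k y)%:E = \int[mu]_t ((k (X t))%:E * (W t)%:E).
  have mpre r : measurable (X @^-1` (k @^-1` [set r])).
    by rewrite -[X in measurable X]setTI; exact: mX.
  rewrite integralT_nnsfun sintegralE.
  under [RHS]eq_integral => t _.
    rewrite fimfunE -fsumEFin//= muleC ge0_mule_fsumr; last first.
      by move=> r; rewrite EFinM nnfun_muleindic_ge0.
    over.
  rewrite ge0_integral_fsum//=; last 2 first.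
  - move=> r; apply: emeasurable_funM => //; apply/measurable_EFinP.
    apply: measurable_funM => //.
    have mind : measurable_fun setT (\1_(k @^-1` [set r]) : T' -> R).
      exact: measurable_indic.
    exact: (measurableT_comp mind).
  - by move=> r t _; rewrite mule_ge0// EFinM nnfun_muleindic_ge0.
  apply: eq_fsbigr => r; rewrite inE => -[y _ <-]{r}.
  rewrite nuE// integral_mkcond epatch_indic -ge0_integralZl//; last 3 first.
  - apply: emeasurable_funM => //; apply/measurable_EFinP.
    exact: measurable_indic.
  - by move=> t _; rewrite mule_ge0// lee_fin.
  - by rewrite lee_fin.
  by apply: eq_integral => t _; rewrite /= EFinM muleCA.
transitivity (\int[nu]_y limn (fun n => (g n y)%:E)).
  by apply: eq_integral => y _; apply/esym/cvg_lim.
rewrite monotone_convergence//; last 2 first.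
- by move=> n; exact/measurable_EFinP.
- by move=> n y _; rewrite lee_fin.
transitivity (limn (fun n => \int[mu]_t ((g n (X t))%:E * (W t)%:E))).
  by congr (limn _); apply/funext => n; exact: simple.
rewrite -monotone_convergence//; last 3 first.
- move=> n; apply: emeasurable_funM => //; apply/measurable_EFinP.
  exact: (measurableT_comp (f := g n)).
- by move=> n t _; rewrite mule_ge0// lee_fin.
- by move=> t _ m n mn; rewrite lee_wpmul2r//; exact: nd_g.
apply: eq_integral => t _; rewrite limeMr//; last by apply/cvg_ex; exists (h (X t)).
by congr (_ * _); apply/cvg_lim.
Qed.

End Density.

(** * Moments of one centered normal variable *)

Section NormalMoments.
Context (R : realType) (sigma : R).
Hypothesis sigma_gt0 : 0 < sigma.
Local Notation p := (normal_pdf 0 sigma).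
Local Notation mu := (@lebesgue_measure R).

Let sigma_neq0 : sigma != 0. Proof. by rewrite gt_eqF. Qed.

Lemma centered_normal_pdfE x :
  p x = normal_peak sigma * expR (- (x ^+ 2 / (2 * sigma ^+ 2))).
Proof.
by rewrite normal_pdfE// /normal_fun subr0 mulNr -mulr_natl.
Qed.

Lemma is_derive_centered_normal_pdf (x : R) :
  is_derive x 1 p (- (x / sigma ^+ 2) * p x).
Proof.
rewrite (_ : p = fun y =>
  normal_peak sigma * expR (- (y ^+ 2 / (2 * sigma ^+ 2)))); last first.
  by apply/funext => y; exact: centered_normal_pdfE.
apply: is_derive_eq.
rewrite /GRing.scale/= !mulr1; field.
exact: sigma_neq0.
Qed.

(** Boundary term of the integration by parts. From exp u >= u^(k+1) / (k+1)! with u = N^2 / (2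
    sigma^2), the term is at most c / N^(k+1), hence at most c / N. *)
Lemma cvg_normal_pdf_exp k :
  (n.+1%:R ^+ k.+1 * p n.+1%:R : R) @[n --> \oo] --> (0 : R).
Proof.
pose c : R := normal_peak sigma * ((k.+1)`!%:R * (2 * sigma ^+ 2) ^+ k.+1).
apply: (@squeeze_cvgr _ _ _ _ (cst 0) (fun n => c * harmonic n)).
- near=> n; rewrite mulr_ge0 ?exprn_ge0 ?normal_pdf_ge0//=.
  have N_gt0 : 0 < n.+1%:R :> R by [].
  have u_gt0 : 0 < n.+1%:R ^+ 2 / (2 * sigma ^+ 2).
    by rewrite divr_gt0 ?mulr_gt0 ?exprn_gt0.
  have /= := expR_ge1Dxn k (ltW u_gt0).
  set u := _ / _ => h.
  have fact_pos : 0 < (k.+1)`!%:R :> R by rewrite ltr0n fact_gt0.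
  have {}h : u ^+ k.+1 / (k.+1)`!%:R <= expR u.
    by apply: le_trans h; rewrite lerDr.
  have N0 : n.+1%:R != 0 :> R by rewrite gt_eqF.
  have {}h : expR (- u) <= (k.+1)`!%:R / u ^+ k.+1.
    rewrite expRN -[leRHS]invrK invf_div lef_pV2 ?posrE ?expR_gt0//.
    by rewrite divr_gt0// exprn_gt0.
  rewrite centered_normal_pdfE -/u /c mulrCA -mulrA ler_wpM2l ?normal_peak_ge0//.
  apply: (le_trans (ler_wpM2l _ h)); first by rewrite exprn_ge0.
  rewrite /u /harmonic/= expr_div_n invf_div -exprM mulrC.
  rewrite -!mulrA ler_wpM2l ?(ltW fact_pos)//.
  rewrite ler_wpM2l ?exprn_ge0 ?mulr_ge0 ?exprn_ge0 ?(ltW sigma_gt0)//.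
  rewrite mulnC muln2 -addnn exprD invfM -mulrA mulVf ?expf_neq0// mulr1.
  rewrite lef_pV2 ?posrE ?exprn_gt0// exprS ler_peMr// exprn_ege1// ler1n//.
- exact: cvg_cst.
- by rewrite -(mulr0 c); apply: cvgM; [exact: cvg_cst|exact: cvg_harmonic].
Unshelve. all: by end_near. Qed.

Let p_continuous : continuous p. Proof. exact: continuous_normal_pdf. Qed.

Let weight_continuous k : continuous (fun x : R => x ^+ k * p x).
Proof.
move=> x; apply: cvgM; last exact: p_continuous.
exact: exprn_continuous.
Qed.

Let weight_integrable k (n : nat) :
  mu.-integrable `[0, n%:R] (EFin \o (fun x : R => x ^+ k * p x)).
Proof.
apply: continuous_compact_integrable; first exact: segment_compact.
exact: continuous_subspaceT.
Qed.

Let Rint k (n : nat) : R := \int[mu]_(x in `[0, n.+1%:R]) (x ^+ k * p x).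

(* Integration by parts, since the derivative of p is -(x / sigma^2) p. *)
Lemma truncated_moment_recurrence k n :
  Rint k.+2 n = sigma ^+ 2 * (k.+1%:R * Rint k n - n.+1%:R ^+ k.+1 * p n.+1%:R).
Proof.
pose F (x : R) := x ^+ k.+1; pose f (x : R) := k.+1%:R * x ^+ k.
pose g (x : R) := - (x / sigma ^+ 2) * p x.
have dF (x : R) : is_derive x 1 F (f x).
  rewrite (_ : F = (id : R -> R) ^+ k.+1); last by apply/funext => y; rewrite fctE.
  by apply: is_derive_eq; rewrite /GRing.scale/= mulr1.
have cF : continuous F by exact: exprn_continuous.
have cf : continuous f.
  by move=> x; apply: cvgM; [exact: cvg_cst|exact: exprn_continuous].
have cg : continuous g.
  move=> x; apply: cvgM; last exact: p_continuous.
  by apply: cvgN; apply: cvgM; [exact: cvg_id|exact: cvg_cst].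
have ibp : \int[mu]_(x in `[0, n.+1%:R]) (F x * g x) =
    (F n.+1%:R * p n.+1%:R - F 0 * p 0)
    - \int[mu]_(x in `[0, n.+1%:R]) (f x * p x).
  apply: Rintegration_by_parts => //.
  - exact: continuous_subspaceT.
  - split=> [x _||].
    + by have [] := dF x.
    + by apply: cvg_at_right_filter; exact: cF.
    + by apply: cvg_at_left_filter; exact: cF.
  - by move=> x _; rewrite derive1E; have [_] := dF x.
  - exact: continuous_subspaceT.
  - split=> [x _||].
    + by have [] := is_derive_centered_normal_pdf x.
    + by apply: cvg_at_right_filter; exact: p_continuous.
    + by apply: cvg_at_left_filter; exact: p_continuous.
  - by move=> x _; rewrite derive1E; have [_] := is_derive_centered_normal_pdf x.
have IF : \int[mu]_(x in `[0, n.+1%:R]) (F x * g x) =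
    - (sigma ^+ 2)^-1 * Rint k.+2 n.
  rewrite -RintegralZl//; apply: eq_Rintegral => x _.
  by rewrite /F /g !exprS; field.
have If : \int[mu]_(x in `[0, n.+1%:R]) (f x * p x) = k.+1%:R * Rint k n.
  by rewrite -RintegralZl//; apply: eq_Rintegral => x _; rewrite /f mulrA.
move: ibp; rewrite IF If /F expr0n mul0r subr0 => e.
have -> : Rint k.+2 n = - sigma ^+ 2 * (- (sigma ^+ 2)^-1 * Rint k.+2 n).
  by field.
by rewrite e; ring.
Qed.

(** Limit of the truncated recurrence. Even exponents make the integrand nonnegative at every x, so
    the truncated integrals converge to the integral over the half-line. *)
Lemma half_moment_recurrence k a : ~~ odd k ->
  (\int[mu]_(x in `[0%R, +oo[) (x ^+ k * p x)%:E = a%:E)%E ->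
  (\int[mu]_(x in `[0%R, +oo[) (x ^+ k.+2 * p x)%:E
    = (sigma ^+ 2 * (k.+1%:R * a))%:E)%E.
Proof.
have cvg_int j : ~~ odd j ->
    (\int[mu]_(x in `[0%R, n.+1%:R]) (x ^+ j * p x)%:E)%E @[n --> \oo] -->
    (\int[mu]_(x in `[0%R, +oo[) (x ^+ j * p x)%:E)%E.
  move=> jeven.
  have := @ge0_cvgn_integral R mu (fun x => x ^+ j * p x) _ _.
  rewrite -cvg_shiftS/=; apply.
    by move=> x; rewrite mulr_ge0 ?normal_pdf_ge0// exprn_even_ge0.
  exact: continuous_measurable_fun.
move=> keven Ma.
have cvgk : Rint k n @[n --> \oo] --> a.
  by apply: fine_cvg; rewrite -Ma; exact: cvg_int.
have cvgk2 : Rint k.+2 n @[n --> \oo] --> sigma ^+ 2 * (k.+1%:R * a).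
  under eq_fun do rewrite truncated_moment_recurrence.
  rewrite -[X in k.+1%:R * X]subr0 mulrBr.
  apply: cvgM; first exact: cvg_cst.
  rewrite mulr0 -[X in _ --> X]/(_ - _).
  apply: cvgB; last exact: cvg_normal_pdf_exp.
  by apply: cvgM; [exact: cvg_cst|].
have k2even : ~~ odd k.+2 by rewrite /= negbK.
rewrite -(cvg_lim _ (cvg_int _ k2even))//; apply/cvg_lim => //.
rewrite [X in X @ _](_ : _ = EFin \o Rint k.+2); last first.
  apply/funext => n /=; rewrite /Rint fineK//.
  by apply: integrable_fin_num => //; exact: weight_integrable.
by apply: cvg_EFin; first exact: nearW.
Qed.

Lemma moment_half k : ~~ odd k ->
  (\int[mu]_x (x ^+ k * p x)%:E =
   2%:E * \int[mu]_(x in `[0%R, +oo[) (x ^+ k * p x)%:E)%E.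
Proof.
move=> keven; rewrite (@ge0_symfun_integralT _ (fun x => x ^+ k * p x))//.
- rewrite (_ : [set x | _] = `[0, +oo[%classic)//.
  by apply/seteqP; split => x/=; rewrite in_itv/= andbT.
- by move=> x; rewrite mulr_ge0 ?normal_pdf_ge0// exprn_even_ge0.
- move=> x /=; rewrite !centered_normal_pdfE sqrrN exprNn -signr_odd.
  by rewrite (negbTE keven) expr0 mul1r.
Qed.

Lemma half_moment0 :
  (\int[mu]_(x in `[0%R, +oo[) (x ^+ 0 * p x)%:E = (2^-1)%:E)%E.
Proof.
have := @moment_half 0 isT.
under eq_integral do rewrite expr0 mul1r.
rewrite integral_normal_pdf; set I := integral _ _ _ => e.
have -> : I = ((2^-1)%:E * (2%:E * I))%E by rewrite muleA -EFinM mulVf// mul1e.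
by rewrite -e mule1.
Qed.

Lemma even_moments :
  [/\ (\int[mu]_x (x ^+ 0 * p x)%:E = 1)%E,
      (\int[mu]_x (x ^+ 2 * p x)%:E = (sigma ^+ 2)%:E)%E &
      (\int[mu]_x (x ^+ 4 * p x)%:E = (3 * sigma ^+ 4)%:E)%E].
Proof.
have m0 := half_moment0.
have m2 := @half_moment_recurrence 0 _ isT m0.
have m4 := @half_moment_recurrence 2 _ isT m2.
rewrite !moment_half// m0 m2 m4 -!EFinM.
by split; congr EFin; field.
Qed.

Let measurable_exprn k : measurable_fun setT (fun x : R => x ^+ k).
Proof. by apply: continuous_measurable_fun; exact: exprn_continuous. Qed.

Context (disp : measure_display) (T : measurableType disp) (P : probability T R)
  (X : {RV P >-> R}).
Hypothesis X_normal : forall A : set R, measurable A ->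
  distribution P X A = normal_prob 0 sigma A.

Lemma ge0_expectation_normal (h : R -> R) :
  measurable_fun setT h -> (forall x, 0 <= h x) ->
  (\int[P]_w (h (X w))%:E = \int[mu]_x (h x * p x)%:E)%E.
Proof.
move=> mh h0.
have <- := @ge0_integral_distribution _ _ _ _ _ P X (EFin \o h) _ _; last 2 first.
- exact/measurable_EFinP.
- by move=> y; rewrite lee_fin.
under [RHS]eq_integral do rewrite EFinM.
apply: (@ge0_integral_density _ _ _ _ _ mu (distribution P X) id p (EFin \o h)) => //.
- exact: measurable_normal_pdf.
- by move=> x; exact: normal_pdf_ge0.
- exact/measurable_EFinP.
Qed.

Let mX k : measurable_fun setT (fun w => X w ^+ k).
Proof. exact: measurable_funX. Qed.

Let integrable_even k : ~~ odd k ->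
  (\int[mu]_x (x ^+ k * p x)%:E < +oo)%E ->
  P.-integrable setT (fun w => (X w ^+ k)%:E).
Proof.
move=> keven koo; apply/integrableP; split; first exact/measurable_EFinP.
under eq_integral do rewrite /= ger0_norm ?exprn_even_ge0//.
rewrite (@ge0_expectation_normal (fun x => x ^+ k))//.
by move=> x; rewrite exprn_even_ge0.
Qed.

(** Domination by 1 + x^4, according to whether |x| is at most 1 or not. *)
Lemma integrable_normal_exp k : (k <= 4)%N ->
  P.-integrable setT (fun w => (X w ^+ k)%:E).
Proof.
move=> k4; have [m0 _ m4] := even_moments.
have i4 : P.-integrable setT (fun w => (X w ^+ 4)%:E).
  by apply: integrable_even => //; rewrite m4 ltry.
have i0 : P.-integrable setT (fun w => (X w ^+ 0)%:E).
  by apply: integrable_even => //; rewrite m0 ltry.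
apply: (le_integrable measurableT _ _ (integrableD measurableT i0 i4)).
  exact/measurable_EFinP.
move=> w _; rewrite /= lee_fin expr0.
rewrite [leRHS]ger0_norm ?addr_ge0 ?ler01 ?exprn_even_ge0// normrX.
have [Xle1|X1] := leP `|X w| 1.
  by rewrite (le_trans (exprn_ile1 k (normr_ge0 _) Xle1))// lerDl exprn_even_ge0.
rewrite -[X w ^+ 4]ger0_norm ?exprn_even_ge0// normrX.
by rewrite (le_trans (ler_weXn2l (ltW X1) k4))// lerDr.
Qed.

Lemma normal_odd_moment k : (k <= 4)%N -> odd k ->
  \int[P]_w (X w ^+ k) = 0.
Proof.
move=> k4 kodd; have ik := integrable_normal_exp k4.
have ikn : P.-integrable setT (EFin \o (fun w => `|X w ^+ k|)).
  exact: integrable_norm.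
pose h (x : R) := Num.max x 0 ^+ k.
have mh : measurable_fun setT h.
  by apply: measurable_funX; exact: measurable_maxr.
have h0 x : 0 <= h x by rewrite exprn_ge0// le_max lexx orbT.
(* For odd k, x^k = 2 max(x, 0)^k - |x|^k, and by symmetry of the density both
   terms have the same expectation; no change of variables x -> -x is needed. *)
have hE x : x ^+ k = 2 * h x - `|x ^+ k|.
  rewrite /h; have [x0|x0] := leP x 0.
    rewrite ler0_norm ?exprn_odd_le0// expr0n.
    case: k kodd {k4 ik ikn mh h h0} => //= k _.
    by rewrite mulr0 sub0r opprK.
  by rewrite ger0_norm ?exprn_ge0 ?ltW//; ring.
pose m := (\int[mu]_(x in [set x | (0 <= x)%R]) (`|x ^+ k| * p x)%:E)%E.
have Eh : (\int[P]_w (h (X w))%:E = m)%E.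
  rewrite ge0_expectation_normal// /m [RHS]integral_mkcond.
  apply: eq_integral => x _; rewrite patchE /h; case: ifPn.
    by move=> /set_mem/= x0; rewrite (max_idPl x0) ger0_norm// exprn_ge0.
  rewrite notin_setE/= => /negP; rewrite -ltNge => x0; rewrite (max_idPr (ltW x0)) expr0n.
  by case: k kodd {k4 ik ikn hE mh h h0 m} => //= k _; rewrite mul0r.
have En : (\int[P]_w (`|X w ^+ k|)%:E = 2%:E * m)%E.
  rewrite (@ge0_expectation_normal (fun x => `|x ^+ k|))//; last first.
    by apply: measurableT_comp => //; exact: measurable_exprn.
  rewrite (@ge0_symfun_integralT _ (fun x => `|x ^+ k| * p x))//.
  - by move=> x; rewrite mulr_ge0 ?normal_pdf_ge0.
  - move=> x; apply: cvgM; last exact: p_continuous.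
    by apply: cvg_norm; exact: exprn_continuous.
  - by move=> x /=; rewrite !centered_normal_pdfE sqrrN !normrX normrN.
have ih : P.-integrable setT (EFin \o (fun w => h (X w))).
  apply: (le_integrable measurableT _ _ ikn).
    by apply/measurable_EFinP; exact: (measurableT_comp mh).
  move=> w _; rewrite /= lee_fin normr_id (ger0_norm (h0 _)) normrX.
  by apply: lerXn2r; rewrite ?nnegrE ?le_max ?lexx ?orbT// ge_max ler_norm normr_ge0.
under eq_Rintegral do rewrite hE.
have i2h : P.-integrable setT (EFin \o (fun w => 2 * h (X w))).
  by apply: eq_integrable (integrableZl measurableT 2 ih) => // w _; rewrite /= EFinM.
rewrite RintegralB//.
rewrite RintegralZl// /Rintegral Eh En.
have mfin : m \is a fin_num by rewrite -Eh integrable_fin_num.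
by rewrite fineM//= subrr.
Qed.

Lemma normal_moments :
  [/\ \int[P]_w (X w ^+ 2) = sigma ^+ 2 & \int[P]_w (X w ^+ 4) = 3 * sigma ^+ 4].
Proof.
have [_ m2 m4] := even_moments.
split; rewrite /Rintegral.
  rewrite (@ge0_expectation_normal (fun x => x ^+ 2)) ?m2//.
  by move=> x; rewrite exprn_even_ge0.
rewrite (@ge0_expectation_normal (fun x => x ^+ 4)) ?m4//.
by move=> x; rewrite exprn_even_ge0.
Qed.

End NormalMoments.

(** * Expectation of a product of independent variables *)

Section Independence.
Context d (T : measurableType d) (R : realType) (P : probability T R) (n : nat)
  (X : 'I_n -> {RV P >-> R}).
Hypothesis X_indep : mutually_independent X.
Implicit Type h : 'I_n -> R -> R.

Let admissible h := forall i, [/\ measurable_fun setT (h i),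
  forall x, 0 <= h i x & (\int[P]_w (h i (X i w))%:E < +oo)%E].

Let E h i : R := \int[P]_w (h i (X i w)).

Let measurable_prod_comp h (Q : pred 'I_n) : (forall i, measurable_fun setT (h i)) ->
  measurable_fun setT (fun w => \prod_(i < n | Q i) h i (X i w)).
Proof.
move=> mh; under eq_fun do rewrite -big_filter; apply: measurable_prod => i _.
exact: (measurableT_comp (mh i)).
Qed.

Lemma ge0_expectation_prod h : admissible h ->
  (\int[P]_w (\prod_(i < n) h i (X i w))%:E = (\prod_(i < n) E h i)%:E)%E.
Proof.
(* Independence is the case of indicators; the factors are then made general one
   at a time, the remaining factors W serving as a density. *)
suff: forall k, (k <= n)%N -> forall h, admissible h ->
    (forall i : 'I_n, (k <= i)%N -> exists2 A, measurable A & h i = \1_A) ->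
    (\int[P]_w (\prod_(i < n) h i (X i w))%:E = (\prod_(i < n) E h i)%:E)%E.
  by move=> /(_ n (leqnn n)) H adm; apply: H => // i; rewrite leqNgt ltn_ord.
elim=> [|k IH] kn {}h adm hind.
  have /choice[A AP] i : exists B, measurable B /\ h i = \1_B.
    by have [B mB hB] := hind i (leq0n i); exists B.
  have mA i : measurable (A i) by have [] := AP i.
  have hA i : h i = \1_(A i) by have [] := AP i.
  have mXA i : measurable (X i @^-1` A i).
    by rewrite -[X in measurable X]setTI; exact: measurable_funPT.
  have := X_indep (J := finset.finset (fun=> true)) (fun i _ => mA i).
  under eq_bigl do rewrite finset.in_set.
  rewrite [X in P X](_ : _ = \bigcap_i (X i @^-1` A i)); last first.
    by apply/seteqP; split=> w /= Xw i; [move=> _; apply: Xw => /=|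
      by move=> _; exact: Xw]; rewrite finset.in_set.
  move=> PA.
  have EA i : E h i = fine (P (X i @^-1` A i)).
    rewrite /E hA /Rintegral.
    rewrite (_ : (fun w => _) = (fun w => (\1_(X i @^-1` A i) w)%:E)).
      by rewrite integral_indic// setIT.
    by apply/funext => w; rewrite !indicE.
  rewrite (_ : (fun w => _) =
    (fun w => (\1_(\bigcap_i (X i @^-1` A i)) w)%:E)); last first.
    apply/funext => w; congr EFin; rewrite indicE.
    under eq_bigr do rewrite hA indicE.
    case: (boolP (w \in _)) => [/set_mem Aw|/negP nAw].
      by rewrite big1// => i _; rewrite mem_set//; exact: Aw.
    have [i Hi] : exists i, ~ (X i @^-1` A i) w.
      by apply/existsNP => H; apply: nAw; apply/mem_set => i _; exact: H.
    by rewrite (bigD1 i)//= memNset// mul0r.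
  have mcap : measurable (\bigcap_i (X i @^-1` A i)).
    exact: fin_bigcap_measurable.
  rewrite integral_indic// setIT; apply: (etrans PA).
  under [in RHS]eq_bigr do rewrite EA.
  by rewrite -prodEFin; apply: eq_bigr => i _; rewrite fineK// fin_num_measure.
pose i0 := Ordinal kn.
pose W w := \prod_(i < n | i != i0) h i (X i w).
have mh i : measurable_fun setT (h i) by have [] := adm i.
have h0 i x : 0 <= h i x by have [] := adm i.
have W0 w : 0 <= W w by apply: prodr_ge0.
pose c := \prod_(i < n | i != i0) E h i.
have c0 : 0 <= c by apply: prodr_ge0 => i _; exact: Rintegral_ge0.
(* The induction hypothesis, with factor k replaced by the indicator of A, says that the law of X_k
   scaled by c is the image under X_k of P weighted by [W]. Integrating the true factor against it
   restores the k-th function. *)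
have key A : measurable A ->
    mscale (NngNum c0) (distribution P (X i0)) A =
    (\int[P]_(w in X i0 @^-1` A) (W w)%:E)%E.
  move=> mA; pose h' i := if i == i0 then \1_A else h i.
  have h'i0 : h' i0 = \1_A by rewrite /h' eqxx.
  have h'i i : i != i0 -> h' i = h i by rewrite /h' => /negbTE ->.
  have mXA : measurable (X i0 @^-1` A).
    by rewrite -[X in measurable X]setTI; exact: measurable_funPT.
  have PA : (\int[P]_w (h' i0 (X i0 w))%:E = P (X i0 @^-1` A))%E.
    rewrite h'i0 (_ : (fun w => _) = (fun w => (\1_(X i0 @^-1` A) w)%:E)).
      by rewrite integral_indic// setIT.
    by apply/funext => w; rewrite !indicE.
  have adm' : admissible h'.
    move=> i; have [->|ii0] := eqVneq i i0; last by rewrite h'i.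
    split; rewrite ?PA; rewrite ?h'i0//.
    by rewrite -ge0_fin_numE// fin_num_measure.
  have := IH (ltnW kn) h' adm' _.
  rewrite [in RHS](bigD1 i0)//= {1}/E /Rintegral PA.
  have -> : \prod_(i < n | i != i0) E h' i = c.
    by apply: eq_bigr => i ii0; rewrite /E h'i.
  rewrite EFinM fineK ?fin_num_measure// => e.
  rewrite /mscale/= muleC /distribution /pushforward -e; last first.
    move=> i ki; have [->|ii0] := eqVneq i i0; first by exists A.
    rewrite h'i//; apply: hind; rewrite ltn_neqAle ki andbT.
    by move: ii0; rewrite -val_eqE eq_sym.
  rewrite [RHS]integral_mkcond epatch_indic; apply: eq_integral => w _.
  rewrite (bigD1 i0)//= EFinM muleC h'i0; congr (_ * _)%E.
  by congr EFin; apply: eq_bigr => i ii0; rewrite h'i.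
have mW : measurable_fun setT W by exact: measurable_prod_comp.
have := ge0_integral_density (@measurable_funPT _ _ _ _ (X i0)) mW W0 key
  (h := EFin \o h i0).
rewrite ge0_integral_mscale//; last 2 first.
- by apply/measurable_EFinP.
- by move=> x _; rewrite lee_fin.
rewrite ge0_integral_distribution//; last 2 first.
- by apply/measurable_EFinP.
- by move=> x; rewrite lee_fin.
move=> /(_ _ _) e.
rewrite [RHS](_ : _ = c%:E * (\int[P]_w (h i0 (X i0 w))%:E))%E; last first.
  rewrite (bigD1 i0)//= EFinM muleC /E /Rintegral fineK// ge0_fin_numE.
    by have [] := adm i0.
  by apply: integral_ge0 => w _; rewrite lee_fin.
rewrite e; last 2 first.
- by apply/measurable_EFinP.
- by move=> x; rewrite lee_fin.
by apply: eq_integral => w _; rewrite (bigD1 i0)//= EFinM.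
Qed.

End Independence.

Section ExpectationProduct.
Context d (T : measurableType d) (R : realType) (P : probability T R).

Definition integrable_real (g : T -> R) : Prop := P.-integrable setT (EFin \o g).

Lemma linear_expectation :
  linear_functional_on integrable_real (fun g => \int[P]_w g w).
Proof.
move=> a g h ig ih.
have iag : P.-integrable setT (EFin \o (fun w => a * g w)).
  by apply: eq_integrable (integrableZl measurableT a ig) => // w _; rewrite /= EFinM.
split; last by rewrite RintegralD// RintegralZl.
by apply: eq_integrable (integrableD measurableT iag ih) => // w _; rewrite /= EFinD.
Qed.

Lemma integrable_real1 : integrable_real (fun=> 1).
Proof. exact: finite_measure_integrable_cst. Qed.

Context (n : nat) (X : 'I_n -> {RV P >-> R}).
Hypothesis X_indep : mutually_independent X.

(** Splitting each h_i into positive and negative parts expands the product into 2^n signed products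
    of nonnegative functions, indexed by the set J of factors taking the positive part. The same
    expansion of the product of expectations matches it term by term. *)
Lemma expectation_prod (h : 'I_n -> R -> R) :
  (forall i, measurable_fun setT (h i)) ->
  (forall i, integrable_real (h i \o X i)) ->
  integrable_real (fun w => \prod_(i < n) h i (X i w)) /\
  \int[P]_w (\prod_(i < n) h i (X i w)) = \prod_(i < n) \int[P]_w (h i (X i w)).
Proof.
move=> mh ih.
have dominated (g : 'I_n -> R -> R) : (forall i, measurable_fun setT (g i)) ->
    (forall i x, 0 <= g i x) -> (forall i x, g i x <= `|h i x|) ->
    (forall i, integrable_real (g i \o X i)) /\
    (\int[P]_w (\prod_(i < n) g i (X i w))%:E =
     (\prod_(i < n) \int[P]_w (g i (X i w)))%:E)%E.
  move=> mg g0 gh.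
  have ig i : integrable_real (g i \o X i).
    apply: (le_integrable measurableT _ _ (ih i)).
      by apply/measurable_EFinP; exact: (measurableT_comp (mg i)).
    by move=> w _; rewrite /= lee_fin ger0_norm.
  split=> //; apply: ge0_expectation_prod => // i; split=> //.
  exact: integrable_lty (ig i).
have mprod (g : 'I_n -> R -> R) : (forall i, measurable_fun setT (g i)) ->
    measurable_fun setT (fun w => \prod_(i < n) g i (X i w)).
  by move=> mg; apply: measurable_prod => i _; exact: (measurableT_comp (mg i)).
have iprod (g : 'I_n -> R -> R) : (forall i, measurable_fun setT (g i)) ->
    (forall i x, `|g i x| <= `|h i x|) ->
    integrable_real (fun w => \prod_(i < n) g i (X i w)).
  move=> mg gh; apply/integrableP; split; first by apply/measurable_EFinP; exact: mprod.
  under eq_integral do rewrite /= normr_prod.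
  have [//|||_ ->] := dominated (fun i x => `|g i x|); last by rewrite ltry.
  - by move=> i; exact: measurableT_comp.
  - by move=> i x; exact: normr_ge0.
  - exact: gh.
split; first exact: iprod.
pose hp i x := Num.max (h i x) 0; pose hn i x := Num.max (- h i x) 0.
have hE i x : h i x = hp i x + - hn i x.
  by rewrite /hp /hn; have [?|?] := leP (h i x) 0; have [?|?] := leP (- h i x) 0; lra.
pose g (J : {set 'I_n}) i := if i \in J then hp i else hn i.
pose s (J : {set 'I_n}) : R := \prod_(i < n) (if i \in J then 1 else -1).
have sg (J : {set 'I_n}) (a b : 'I_n -> R) :
    \prod_i (if i \in J then a i else - b i) =
    s J * \prod_i (if i \in J then a i else b i).
  rewrite -big_split/=; apply: eq_bigr => i _.
  by case: ifP => _; rewrite ?mul1r ?mulN1r.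
have mg J i : measurable_fun setT (g J i).
  rewrite /g; case: ifP => _; apply: measurable_maxr => //.
  exact: measurableT_comp.
have g0 J i x : 0 <= g J i x by rewrite /g; case: ifP => _; rewrite le_max lexx orbT.
have gh J i x : g J i x <= `|h i x|.
  rewrite /g; case: ifP => _; rewrite ge_max normr_ge0 andbT ?ler_norm//.
  by rewrite ler_normr lexx orbT.
have igJ J : integrable_real (fun w => \prod_(i < n) g J i (X i w)).
  by apply: iprod => // i x; rewrite ger0_norm.
have [_ Esum] := functional_sum linear_expectation integrable_real1 s igJ.
transitivity (\int[P]_w (\sum_(J : {set 'I_n}) s J * \prod_(i < n) g J i (X i w))).
  apply: eq_Rintegral => w _; under eq_bigr do rewrite hE.
  rewrite bigA_distr; apply: eq_bigr => J _; rewrite sg; congr (_ * _).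
  by apply: eq_bigr => i _; rewrite /g; case: ifP.
rewrite Esum.
(* The two extreme choices of J give integrability of all positive parts and of all negative
   parts. *)
pose JT : {set 'I_n} := finset.finset (fun=> true).
pose J0 : {set 'I_n} := finset.finset (fun=> false).
have Eh i : \int[P]_w (h i (X i w)) =
    \int[P]_w (hp i (X i w)) + - \int[P]_w (hn i (X i w)).
  have [ip _] := dominated _ (mg JT) (g0 JT) (gh JT).
  have [im _] := dominated _ (mg J0) (g0 J0) (gh J0).
  rewrite -RintegralB//.
  - by apply: eq_Rintegral => w _; rewrite hE.
  - by have := ip i; rewrite /g finset.in_set.
  - by have := im i; rewrite /g finset.in_set.
under [RHS]eq_bigr do rewrite Eh.
rewrite bigA_distr; apply: eq_bigr => J _; rewrite sg; congr (_ * _).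
have [_ EJ] := dominated _ (mg J) (g0 J) (gh J).
rewrite /Rintegral EJ/=; apply: eq_bigr => i _.
by rewrite /g /Rintegral; case: ifP.
Qed.

End ExpectationProduct.

(** * Mixed moments of an independent Gaussian family *)

Section GaussianFamily.
Context d (T : measurableType d) (R : realType) (P : probability T R) (n : nat)
  (X : 'I_n -> {RV P >-> R}) (sigma : R).
Hypothesis sigma_gt0 : 0 < sigma.
Hypothesis X_indep : mutually_independent X.
Hypothesis X_normal : forall (i : 'I_n) (A : set R), measurable A ->
  distribution P (X i) A = normal_prob 0 sigma A.

Let D := @integrable_real _ _ R P.
Let E (g : T -> R) : R := \int[P]_w g w.
Let E_linear := @linear_expectation _ _ R P.
Let D1 : D (fun=> 1) := @integrable_real1 _ _ R P.

Let moment (k : nat) : R :=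
  if k == 0%N then 1 else if k == 2 then sigma ^+ 2
  else if k == 4 then 3 * sigma ^+ 4 else 0.

Let E_exp i k : (k <= 4)%N -> E (fun w => X i w ^+ k) = moment k.
Proof.
move=> k4; rewrite /moment; have [m2 m4] := normal_moments sigma_gt0 (X_normal i).
case: eqP => [->|k0].
  rewrite /E; under eq_Rintegral do rewrite expr0.
  by rewrite Rintegral_cst// mul1r; apply: (congr1 fine (probability_setT P)).
case: eqP => [->//|k2]; case: eqP => [->//|k4N].
apply: (normal_odd_moment sigma_gt0 (X_normal i)) => //.
by case: k k4 k0 k2 k4N => [|[|[|[|[|]]]]].
Qed.

(** Grouping repeated letters gives one power per variable, the form to which independence
    applies. *)
Let word_prod (s : seq 'I_n) w : \prod_(i <- s) X i w =
  \prod_(i < n) X i w ^+ count_mem i s.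
Proof.
elim: s => [|j s IH]; first by rewrite big_nil big1.
rewrite big_cons IH [RHS](eq_bigr (fun i => X i w ^+ (j == i) * X i w ^+ count_mem i s)).
  rewrite big_split/=; congr (_ * _).
  rewrite (bigD1 j)//= eqxx big1 ?mulr1// => i ij.
  by rewrite eq_sym (negbTE ij).
by move=> i _; rewrite -exprD.
Qed.

Lemma gaussian_word (s : seq 'I_n) : (size s <= 4)%N ->
  D (fun w => \prod_(i <- s) X i w) /\
  E (fun w => \prod_(i <- s) X i w) = \prod_(i < n) moment (count_mem i s).
Proof.
move=> s4; have c4 i : (count_mem i s <= 4)%N.
  exact: leq_trans (count_size _ _) s4.
rewrite (_ : (fun w => _) = fun w => \prod_(i < n) X i w ^+ count_mem i s); last first.
  by apply/funext => w; exact: word_prod.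
have [|i|iD eD] := expectation_prod X_indep (h := fun i x => x ^+ count_mem i s).
- by move=> i; apply: continuous_measurable_fun; exact: exprn_continuous.
- exact: (integrable_normal_exp sigma_gt0 (X_normal i)).
split=> //; apply: (etrans eD); apply: eq_bigr => i _; exact: E_exp.
Qed.

Lemma gaussian_word_odd (s : seq 'I_n) i : (size s <= 4)%N ->
  odd (count_mem i s) -> E (fun w => \prod_(i <- s) X i w) = 0.
Proof.
move=> s4 si; have [_ ->] := gaussian_word s4.
rewrite (bigD1 i)//= [moment _](_ : _ = 0) ?mul0r//.
by rewrite /moment; case: (count_mem i s) si => [|[|[|[|[|]]]]].
Qed.

Let M4 i j k l : R := E (fun w => X i w * (X j w * (X k w * X l w))).

Let M4E i j k l : M4 i j k l = E (fun w => \prod_(i <- [:: i; j; k; l]) X i w).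
Proof.
by congr E; apply/funext => w; rewrite !big_cons big_nil mulr1.
Qed.

Let odd_at m i j k l : odd (count_mem m [:: i; j; k; l]) -> M4 i j k l = 0.
Proof. by move=> h; rewrite M4E (gaussian_word_odd _ h). Qed.

(** The term 2 raises the value at i = k = l from 1 to the kurtosis 3. For k different from l, some
    letter occurs an odd number of times. *)
Let M4_pair i k l :
  M4 i i k l = sigma ^+ 4 * ((k == l)%:R + 2 * ((i == k)%:R * (i == l)%:R)).
Proof.
have [<-{l}|kl] := eqVneq k l.
  rewrite M4E (gaussian_word _).2//=.
  have [<-{k}|ik] := eqVneq i k.
    rewrite (bigD1 i)//= big1 ?eqxx; first by rewrite /moment/=; ring.
    by move=> j ji; rewrite eq_sym (negbTE ji).
  rewrite (bigD1 i)//= (bigD1 k)//=; last by rewrite eq_sym.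
  rewrite !eqxx (eq_sym k) !(negbTE ik) big1.
    by rewrite /moment/=; ring.
  by move=> j /andP[ji jk]; rewrite eq_sym (negbTE ji) eq_sym (negbTE jk).
rewrite add0r; have [ik|ik] := eqVneq i k.
  rewrite -{}ik in kl *; rewrite (negbTE kl) !mulr0; apply: (@odd_at l).
  by rewrite /= eqxx (negbTE kl).
rewrite mul0r !mulr0; apply: (@odd_at k).
by rewrite /= eqxx (negbTE ik) eq_sym (negbTE kl).
Qed.

(** Either i equals another letter, which a permutation brings next to it, or i occurs once and the
    moment vanishes. *)
Lemma gaussian_word4 i j k l :
  E (fun w => X i w * (X j w * (X k w * X l w))) = sigma ^+ 4 *
    ((i == j)%:R * (k == l)%:R + (i == k)%:R * (j == l)%:R
     + (i == l)%:R * (j == k)%:R).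
Proof.
rewrite -/(M4 i j k l).
have [<-{j}|ij] := eqVneq i j; first by rewrite M4_pair mul1r; ring.
have [<-{k}|ik] := eqVneq i k.
  have -> : M4 i j i l = M4 i i j l.
    by congr E; apply/funext => w; ring.
  by rewrite M4_pair (eq_sym j i) (negbTE ij) !(mul0r, mulr0) mul1r; ring.
have [<-{l}|il] := eqVneq i l.
  have -> : M4 i j k i = M4 i i j k.
    by congr E; apply/funext => w; ring.
  by rewrite M4_pair (eq_sym j i) (negbTE ij) !(mul0r, mulr0) mul1r; ring.
rewrite !mul0r !addr0 mulr0; apply: (@odd_at i) => /=.
by rewrite eqxx !(eq_sym _ i) (negbTE ij) (negbTE ik) (negbTE il).
Qed.

Lemma gaussian_word3 i j k : E (fun w => X i w * (X j w * X k w)) = 0.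
Proof.
have e a b c : E (fun w => X a w * (X b w * X c w)) =
    E (fun w => \prod_(i <- [:: a; b; c]) X i w).
  by congr E; apply/funext => w; rewrite !big_cons big_nil mulr1.
have pair a c : E (fun w => X a w * (X a w * X c w)) = 0.
  rewrite e; apply: (@gaussian_word_odd _ c) => //=.
  by rewrite eqxx; case: eqP.
have [<-//|ij] := eqVneq i j.
have [<-|ik] := eqVneq i k.
  by rewrite -(pair i j); congr E; apply/funext => w; ring.
rewrite e; apply: (@gaussian_word_odd _ i) => //=.
by rewrite eqxx !(eq_sym _ i) (negbTE ij) (negbTE ik).
Qed.

Lemma gaussian_word2 i j : E (fun w => X i w * X j w) = sigma ^+ 2 * (i == j)%:R.
Proof.
have e a b : E (fun w => X a w * X b w) =
    E (fun w => \prod_(i <- [:: a; b]) X i w).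
  by congr E; apply/funext => w; rewrite !big_cons big_nil mulr1.
rewrite e; have [<-|ij] := eqVneq i j.
  rewrite (gaussian_word _).2//= (bigD1 i)//= eqxx big1 ?mulr1//.
  by move=> k ki; rewrite eq_sym (negbTE ki).
rewrite mulr0; apply: (@gaussian_word_odd _ i) => //=.
by rewrite eqxx eq_sym (negbTE ij).
Qed.

Lemma gaussian_word1 i : E (X i) = 0.
Proof.
rewrite (_ : X i = (fun w => \prod_(i <- [:: i]) X i w) :> (T -> R)).
  by apply: (@gaussian_word_odd _ i) => //=; rewrite eqxx.
by apply/funext => w; rewrite big_seq1.
Qed.

Definition noise_vector w : 'rV[R]_n := \row_i X i w.

Let sum_delta (u : 'I_n -> R) k : \sum_i u i * (k == i)%:R = u k.
Proof.
rewrite (bigD1 k)//= eqxx mulr1 big1 ?addr0// => i ik.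
by rewrite eq_sym (negbTE ik) mulr0.
Qed.

Let form_step (u : 'I_n -> R) (G : T -> R) (e : 'I_n -> R) :
  (forall i, D (fun w => X i w * G w) /\ E (fun w => X i w * G w) = e i) ->
  D (fun w => linear_form u (noise_vector w) * G w) /\
  E (fun w => linear_form u (noise_vector w) * G w) = \sum_i u i * e i.
Proof.
move=> h.
have -> : (fun w => linear_form u (noise_vector w) * G w) =
    fun w => \sum_i u i * (X i w * G w).
  apply/funext => w; rewrite /linear_form mulr_suml.
  by apply: eq_bigr => i _; rewrite mxE mulrA.
have [DS ES] := functional_sum E_linear D1 u (fun i => (h i).1).
by split=> //; apply: (etrans ES); apply: eq_bigr => i _; congr (_ * _); exact: (h i).2.
Qed.

Let form_step_ext (u : 'I_n -> R) (F G : T -> R) (Y : 'I_n -> T -> R) (e : 'I_n -> R) r :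
  (forall i, D (Y i) /\ E (Y i) = e i) ->
  (forall i, Y i = fun w => X i w * G w) ->
  F = (fun w => linear_form u (noise_vector w) * G w) ->
  \sum_i u i * e i = r ->
  D F /\ E F = r.
Proof.
move=> hY YE -> <-; apply: form_step => i.
by rewrite -YE.
Qed.

Let D_word (s : seq 'I_n) (G : T -> R) : (size s <= 4)%N ->
  (forall w, G w = \prod_(i <- s) X i w) -> D G.
Proof.
move=> s4 e; rewrite (_ : G = fun w => \prod_(i <- s) X i w).
  exact: (gaussian_word s4).1.
exact/funext.
Qed.

(** Letters are replaced by linear forms one slot at a time. Each intermediate identity, contracted
    with one more vector, gives the next, so integrability and value always travel together. *)
Lemma gaussian_linear_form_moments :
  linear_form_moments D E noise_vector (sigma ^+ 2) (gaussian_tensor (sigma ^+ 2)).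
Proof.
pose l u w := linear_form u (noise_vector w).
have L1 t : D (l t) /\ E (l t) = 0.
  apply: (@form_step_ext t _ (fun=> 1) (fun i => X i) (fun=> 0)).
  - move=> i; split; last exact: gaussian_word1.
    by apply: (@D_word [:: i]) => // w; rewrite big_seq1.
  - by move=> i; apply/funext => w; rewrite mulr1.
  - by apply/funext => w; rewrite mulr1.
  - by rewrite big1// => i _; rewrite mulr0.
have L2a j t : D (fun w => l t w * X j w) /\
    E (fun w => l t w * X j w) = sigma ^+ 2 * t j.
  apply: (@form_step_ext t _ (X j) (fun i w => X i w * X j w)
    (fun i => sigma ^+ 2 * (i == j)%:R)) => //.
  - move=> i; split; last exact: gaussian_word2.
    by apply: (@D_word [:: i; j]) => // w; rewrite !big_cons big_nil mulr1.
  - rewrite -[in RHS](sum_delta t j) mulr_sumr; apply: eq_bigr => i _.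
    by rewrite eq_sym mulrCA.
have L2 t u : D (fun w => l t w * l u w) /\
    E (fun w => l t w * l u w) = sigma ^+ 2 * dotp t u.
  apply: (@form_step_ext t _ (l u) (fun i w => l u w * X i w)
    (fun i => sigma ^+ 2 * u i)) => //.
  - by move=> i; apply/funext => w; rewrite mulrC.
  - by rewrite /dotp mulr_sumr; apply: eq_bigr => i _; rewrite mulrCA.
have L3a j k t : D (fun w => l t w * (X j w * X k w)) /\
    E (fun w => l t w * (X j w * X k w)) = 0.
  apply: (@form_step_ext t _ _ (fun i w => X i w * (X j w * X k w)) (fun=> 0)) => //.
  - move=> i; split; last exact: gaussian_word3.
    by apply: (@D_word [:: i; j; k]) => // w; rewrite !big_cons big_nil mulr1.
  - by rewrite big1// => i _; rewrite mulr0.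
have L3b k t u : D (fun w => l t w * (l u w * X k w)) /\
    E (fun w => l t w * (l u w * X k w)) = 0.
  apply: (@form_step_ext t _ (fun w => l u w * X k w)
    (fun i w => l u w * (X i w * X k w)) (fun=> 0)) => //.
  - by move=> i; apply/funext => w; rewrite mulrCA.
  - by rewrite big1// => i _; rewrite mulr0.
have L3 t u p : D (fun w => l t w * l u w * l p w) /\
    E (fun w => l t w * l u w * l p w) = 0.
  apply: (@form_step_ext t _ (fun w => l u w * l p w)
    (fun i w => l u w * (l p w * X i w)) (fun=> 0)) => //.
  - by move=> i; apply/funext => w; rewrite [RHS]mulrC mulrA.
  - by apply/funext => w; rewrite mulrA.
  - by rewrite big1// => i _; rewrite mulr0.
pose s2 := (sigma ^+ 2) ^+ 2.
have s4E : sigma ^+ 4 = s2 by rewrite /s2 -exprM.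
have L4a j k m t : D (fun w => l t w * (X j w * (X k w * X m w))) /\
    E (fun w => l t w * (X j w * (X k w * X m w))) =
    s2 * (t j * (k == m)%:R + t k * (j == m)%:R + t m * (j == k)%:R).
  apply: (@form_step_ext t _ _ (fun i w => X i w * (X j w * (X k w * X m w)))
    (fun i => s2 * ((i == j)%:R * (k == m)%:R + (i == k)%:R * (j == m)%:R
     + (i == m)%:R * (j == k)%:R))) => //.
  - move=> i; split; last by rewrite -s4E; exact: gaussian_word4.
    by apply: (@D_word [:: i; j; k; m]) => // w; rewrite !big_cons big_nil mulr1.
  - rewrite -(sum_delta t j) -(sum_delta t k) -(sum_delta t m).
    rewrite !mulr_suml -!big_split/= mulr_sumr; apply: eq_bigr => i _.
    by rewrite !(eq_sym _ i); ring.
have L4b k m t u : D (fun w => l t w * (l u w * (X k w * X m w))) /\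
    E (fun w => l t w * (l u w * (X k w * X m w))) =
    s2 * (dotp t u * (k == m)%:R + t k * u m + t m * u k).
  apply: (@form_step_ext t _ (fun w => l u w * (X k w * X m w))
    (fun i w => l u w * (X i w * (X k w * X m w)))
    (fun j => s2 * (u j * (k == m)%:R + u k * (j == m)%:R + u m * (j == k)%:R))) => //.
  - by move=> i; apply/funext => w; rewrite mulrCA.
  - rewrite -{1}(sum_delta t k) -(sum_delta t m) /dotp.
    rewrite !mulr_suml -!big_split/= mulr_sumr; apply: eq_bigr => i _.
    by rewrite !(eq_sym _ i); ring.
have L4c m t u p : D (fun w => l t w * (l u w * (l p w * X m w))) /\
    E (fun w => l t w * (l u w * (l p w * X m w))) =
    s2 * (dotp u p * t m + dotp t u * p m + dotp t p * u m).
  apply: (@form_step_ext t _ (fun w => l u w * (l p w * X m w))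
    (fun i w => l u w * (l p w * (X i w * X m w)))
    (fun k => s2 * (dotp u p * (k == m)%:R + u k * p m + u m * p k))) => //.
  - by move=> i; apply/funext => w; ring.
  - rewrite -{1}(sum_delta t m) [dotp t u]/dotp [dotp t p]/dotp.
    rewrite mulr_sumr !mulr_suml -!big_split/= mulr_sumr; apply: eq_bigr => i _.
    by rewrite !(eq_sym _ i); ring.
have L4 t u p q : D (fun w => l t w * l u w * l p w * l q w) /\
    E (fun w => l t w * l u w * l p w * l q w) = gaussian_tensor (sigma ^+ 2) t u p q.
  apply: (@form_step_ext t _ (fun w => l u w * (l p w * l q w))
    (fun i w => l u w * (l p w * (l q w * X i w)))
    (fun m => s2 * (dotp p q * u m + dotp u p * q m + dotp u q * p m))) => //.
  - by move=> i; apply/funext => w; ring.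
  - by apply/funext => w; rewrite -!mulrA.
  - rewrite /gaussian_tensor -/s2 [dotp t u]/dotp [dotp t p]/dotp [dotp t q]/dotp.
    rewrite !mulr_suml -!big_split/= mulr_sumr; apply: eq_bigr => i _.
    by ring.
split=> //; split=> //.
by rewrite /E Rintegral_cst// mul1r; apply: (congr1 fine (probability_setT P)).
Qed.

End GaussianFamily.

(** * Prediction uncertainty of the quadratic model *)

Lemma variance_integrable (disp : measure_display) (T : measurableType disp)
    (R : realType) (P : probability T R) (g : T -> R) :
  let mean := \int[P]_w g w in
  integrable_real P g -> integrable_real P (fun w => (g w - mean) ^+ 2) ->
  'V_P[g]%E = (\int[P]_w ((g w - mean) ^+ 2))%:E.
Proof.
move=> mean ig iv.
rewrite /variance covariance.unlock expectation.unlock /Rintegral fineK.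
  by apply: eq_integral => w _; rewrite expr2.
exact: integrable_fin_num.
Qed.

Lemma sum_sq_le_sq_sum (R : realDomainType) (d : nat) (gamma : 'I_d -> R) :
  (forall k l, 0 <= gamma k * gamma l) ->
  \sum_k gamma k ^+ 2 <= \sum_k \sum_l gamma k * gamma l.
Proof.
move=> g0; apply: ler_sum => k _.
by rewrite (bigD1 k)//= -expr2 lerDl sumr_ge0.
Qed.

Section QuadraticModel.
Context (R : realType) (d n : nat) (alpha beta : 'I_d -> R)
  (xs : 'I_n -> 'rV[R]_d) (theta : 'rV[R]_d.+1) (sigma : R).
Hypothesis n_gt0 : (0 < n)%N.
Hypothesis alpha_neq0 : forall k, alpha k != 0.
Hypothesis xs_vert : forall i, vertices R d (xs i).
Hypothesis xs_sum : \sum_(i < n) xs i = 0.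
Hypothesis xs_orth : forall k l : 'I_d,
  \sum_(i < n) xs i 0 k * xs i 0 l = n%:R * (k == l)%:R.
Hypothesis sigma_gt0 : 0 < sigma.

Local Notation f := (quad_model alpha beta).
Local Notation y := (model_values f xs theta).
Local Notation gamma := (curvature alpha beta).
Local Notation v := (design_coef xs).
Local Notation w := (prediction_coef xs alpha beta).

Let n_neq0 : n%:R != 0 :> R. Proof. by rewrite pnatr_eq0 -lt0n. Qed.

Lemma dotp_design_coef k l : dotp (v k) (v l) = n%:R^-1 * (k == l)%:R.
Proof.
rewrite /dotp (eq_bigr (fun i => n%:R^-1 ^+ 2 * (xs i 0 k * xs i 0 l))).
  by rewrite -mulr_sumr xs_orth mulrA expr2 mulfVK.
by move=> i _; rewrite /design_coef; ring.
Qed.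

Lemma dotp_design_coef_diag k : dotp (v k) (v k) = n%:R^-1.
Proof. by rewrite dotp_design_coef eqxx mulr1. Qed.

Definition gaussian_variance (x : 'rV[R]_d) : R :=
  sigma ^+ 2 * dotp (w x theta) (w x theta)
  + 2 * sigma ^+ 4 / n%:R ^+ 2 * \sum_(k < d) gamma x k ^+ 2.

Lemma gaussian_quadratic_form x :
  \sum_(k < d) \sum_(l < d) gamma x k * gamma x l *
    (gaussian_tensor (sigma ^+ 2) (v k) (v k) (v l) (v l)
     - (sigma ^+ 2 * n%:R^-1) ^+ 2) =
  2 * sigma ^+ 4 / n%:R ^+ 2 * \sum_(k < d) gamma x k ^+ 2.
Proof.
rewrite mulr_sumr; apply: eq_bigr => k _.
rewrite (bigD1 k)//= [X in _ + X]big1 ?addr0.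
  by rewrite /gaussian_tensor !dotp_design_coef eqxx !mulr1; field.
move=> l lk; rewrite /gaussian_tensor !dotp_design_coef !eqxx eq_sym (negbTE lk).
by rewrite !(mulr0, mulr1, addr0); ring.
Qed.

Lemma V_cubature_gaussian_moments (Q : ('rV[R]_n -> R) -> R) x :
  linear_functional_on setT Q ->
  linear_form_moments setT Q id (sigma ^+ 2) (gaussian_tensor (sigma ^+ 2)) ->
  V_cubature Q f xs y x = gaussian_variance x.
Proof.
move=> Qlin Qmom.
rewrite /V_cubature; have -> : perturbed_prediction f xs y x = fun z =>
    f x theta + linear_form (w x theta) z
    + \sum_(k < d) gamma x k * linear_form (v k) z ^+ 2.
  by apply/funext => z; rewrite perturbed_predictionE.
have [_ _ ->] := quadratic_variance Qlin I (f x theta) (w x theta) (gamma x)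
  Qmom dotp_design_coef_diag.
by rewrite gaussian_quadratic_form.
Qed.

(** The entries of v_k are +-1/n, so the diagonal tensor takes the value (n + kappa) sigma^4 / n^3
    whether or not k = l. Subtracting sigma^4 / n^2 leaves kappa sigma^4 / n^3 for all pairs. *)
Lemma V_SP_quadratic kappa x : 0 < n%:R + kappa ->
  V_cubature (Q_SP kappa sigma) f xs y x =
  sigma ^+ 2 * dotp (w x theta) (w x theta)
  + kappa * sigma ^+ 4 / n%:R ^+ 3 * \sum_(k < d) \sum_(l < d) gamma x k * gamma x l.
Proof.
move=> nk.
rewrite /V_cubature; have -> : perturbed_prediction f xs y x = fun z =>
    f x theta + linear_form (w x theta) z
    + \sum_(k < d) gamma x k * linear_form (v k) z ^+ 2.
  by apply/funext => z; rewrite perturbed_predictionE.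
have [_ _ ->] := quadratic_variance (@linear_Q_SP R n kappa sigma) I (f x theta)
  (w x theta) (gamma x) (Q_SP_moments sigma nk) dotp_design_coef_diag.
congr (_ + _); rewrite mulr_sumr; apply: eq_bigr => k _.
rewrite mulr_sumr; apply: eq_bigr => l _.
rewrite (eq_bigr (fun=> n%:R^-1 ^+ 4)).
  rewrite sumr_const card_ord -[(_ ^+ 4) *+ n]mulr_natl; field.
  exact: n_neq0.
by move=> i _; rewrite /design_coef; case: (xs_vert i k) => ->;
  case: (xs_vert i l) => ->; ring.
Qed.

Context (disp : measure_display) (T : measurableType disp) (P : probability T R)
  (eps : 'I_n -> {RV P >-> R}).
Hypothesis eps_indep : mutually_independent eps.
Hypothesis eps_normal : forall (i : 'I_n) (A : set R), measurable A ->
  distribution P (eps i) A = normal_prob 0 sigma A.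
Local Notation Y := (noisy_observations f xs theta eps).

Lemma noisy_observationsE t : Y t = y + noise_vector eps t.
Proof. by apply/rowP => i; rewrite !mxE. Qed.

(** The quadratic coefficients are free: [curvature] gives the exact variance and 0 the linearized
    one. *)
Let variance_prediction (F : T -> R) (c : R) x (g : 'I_d -> R) :
  (forall t, F t = c + linear_form (w x theta) (noise_vector eps t)
    + \sum_(k < d) g k * linear_form (v k) (noise_vector eps t) ^+ 2) ->
  'V_P[F]%E = (sigma ^+ 2 * dotp (w x theta) (w x theta) +
    \sum_(k < d) \sum_(l < d) g k * g l *
    (gaussian_tensor (sigma ^+ 2) (v k) (v k) (v l) (v l)
     - (sigma ^+ 2 * n%:R^-1) ^+ 2))%:E.
Proof.
move=> /funext ->.
have [ig iv <-] := quadratic_variance (linear_expectation (P := P))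
  (integrable_real1 P) c (w x theta) g
  (gaussian_linear_form_moments sigma_gt0 eps_indep eps_normal)
  dotp_design_coef_diag.
exact: variance_integrable.
Qed.

Lemma V_exact_quadratic x : V_exact P f xs Y x = (gaussian_variance x)%:E.
Proof.
rewrite /V_exact (@variance_prediction _ (f x theta) x (gamma x)).
  by rewrite gaussian_quadratic_form.
by move=> t; rewrite noisy_observationsE quad_prediction.
Qed.

Lemma V_LIN_quadratic x :
  V_LIN P f xs y Y x = (sigma ^+ 2 * dotp (w x theta) (w x theta))%:E.
Proof.
rewrite /V_LIN /V_exact lse_quad_noise_free//.
rewrite (@variance_prediction _ (f x theta) x (fun=> 0)).
  rewrite [X in _ + X]big1 ?addr0// => k _.
  by rewrite big1// => l _; rewrite !mul0r.
move=> t; rewrite noisy_observationsE linearized_prediction//.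
by rewrite [X in _ = _ + X]big1 ?addr0// => k _; rewrite mul0r.
Qed.

Lemma curvature_same_sign x :
  (forall k, beta k < 0) \/ (forall k, 0 < beta k) -> cube R d x ->
  forall k l, 0 <= gamma x k * gamma x l.
Proof.
move=> hbeta hx k l.
have x2 j : x 0 j ^+ 2 - 1 <= 0.
  by have /andP[? ?] := hx j; nra.
have -> : gamma x k * gamma x l = (beta k * beta l) *
    ((x 0 k ^+ 2 - 1) * (x 0 l ^+ 2 - 1)) / ((2 * alpha k * alpha l) ^+ 2).
  by rewrite /curvature; field; rewrite !alpha_neq0.
rewrite divr_ge0 ?sqr_ge0// mulr_ge0 ?(mulr_le0 (x2 _) (x2 _))//.
by case: hbeta => hb; [rewrite mulr_le0 ?ltW|rewrite mulr_ge0 ?ltW].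
Qed.

Lemma curvature_neq0 (x : 'rV[R]_d) k : beta k != 0 -> x 0 k != -1 -> x 0 k != 1 ->
  gamma x k != 0.
Proof.
move=> bk xN1 x1; rewrite /curvature mulf_neq0 ?invr_eq0 ?mulf_neq0 ?expf_neq0//.
by rewrite subr_eq0 sqrf_eq1 negb_or x1.
Qed.

Lemma sum_curvature_sq_gt0 x :
  (forall k, beta k < 0) \/ (forall k, 0 < beta k) -> ~ vertices R d x ->
  0 < \sum_(k < d) gamma x k ^+ 2.
Proof.
move=> hbeta /existsNP[k /not_orP[/eqP xN1 /eqP x1]].
rewrite (bigD1 k)//= ltr_wpDr ?sumr_ge0// => [l _|]; first exact: sqr_ge0.
rewrite exprn_even_gt0//= curvature_neq0//.
by case: hbeta => /(_ k) hb; [rewrite lt_eqF|rewrite gt_eqF].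
Qed.

End QuadraticModel.

Unset Implicit Arguments.

Theorem corollary6 (R : realType) (d n : nat) (hd : (1 <= d)%N) (hn : (1 <= n)%N)
    (alpha beta : 'I_d -> R) (halpha : forall k, alpha k != 0)
    (xs : 'I_n -> 'rV[R]_d)
    (hxs_vert : forall i, vertices R d (xs i))
    (hxs_sum : \sum_(i < n) xs i = 0)
    (hxs_orth : forall k l : 'I_d,
       \sum_(i < n) xs i 0 k * xs i 0 l = n%:R * (k == l)%:R)
    (thetastar : 'rV[R]_d.+1) (sigma : R) (hsigma : 0 < sigma)
    (disp : measure_display) (T : measurableType disp) (P : probability T R)
    (eps : 'I_n -> {RV P >-> R})
    (heps_indep : mutually_independent eps)
    (heps_normal : forall (i : 'I_n) (A : set R), measurable A ->
       distribution P (eps i) A = normal_prob 0 sigma A) :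
  let f := quad_model alpha beta in
  let Y := noisy_observations f xs thetastar eps in
  let y := model_values f xs thetastar in
  ((forall k, beta k < 0) \/ (forall k, 0 < beta k) ->
   forall kappa : R, 2 * n%:R < kappa ->
   forall x : 'rV[R]_d, (cube R d `\` vertices R d) x ->
     (V_LIN P f xs y Y x < V_exact P f xs Y x)%E /\
     (V_exact P f xs Y x < (V_cubature (Q_SP kappa sigma) f xs y x)%:E)%E) /\
  (forall x : 'rV[R]_d, cube R d x ->
     (V_cubature (Q_MS sigma) f xs y x)%:E = V_exact P f xs Y x /\
     V_exact P f xs Y x = (V_cubature (Q_LD sigma) f xs y x)%:E).
Proof.
move=> f Y y.
(* A single design point would have to be zero, against its coordinates being +-1; d >= 1 supplies
   such a coordinate. *)
have n_gt1 : (1 < n)%N.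
  rewrite ltn_neqAle hn andbT; apply/eqP => n1; subst n.
  have := design_sum hxs_sum (Ordinal hd); rewrite big_ord1.
  by case: (hxs_vert ord0 (Ordinal hd)) => ->; lra.
have n_gt0 : 0 < n%:R :> R by rewrite ltr0n.
have VE := @V_exact_quadratic _ _ _ _ _ _ thetastar _ hn halpha hxs_vert hxs_sum
  hxs_orth hsigma _ _ _ _ heps_indep heps_normal.
split=> [hbeta kappa hkappa x [xcube xvert]|x _].
  have kappa_gt0 : 0 < kappa by apply: lt_trans hkappa; rewrite mulr_gt0.
  have -> := @V_LIN_quadratic _ _ _ _ _ _ thetastar _ hn halpha hxs_vert hxs_sum
    hxs_orth hsigma _ _ _ _ heps_indep heps_normal x.
  rewrite VE V_SP_quadratic ?addr_gt0//.
  rewrite !lte_fin /gaussian_variance ltrDl ltrD2l.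
  have sq_gt0 := sum_curvature_sq_gt0 halpha hbeta xvert.
  have sq_le := sum_sq_le_sq_sum (curvature_same_sign halpha hbeta xcube).
  have coef_gt0 : 0 < 2 * sigma ^+ 4 / n%:R ^+ 2.
    by rewrite divr_gt0 ?mulr_gt0 ?exprn_gt0.
  split; first exact: mulr_gt0.
  (* After multiplication by n^3 / sigma^4 this is exactly 2 n < kappa. It provides the strictness;
     the comparison of sums only gives a weak inequality, which is an equality when d = 1. *)
  have coef_lt : 2 * sigma ^+ 4 / n%:R ^+ 2 < kappa * sigma ^+ 4 / n%:R ^+ 3.
    rewrite ltr_pdivlMr ?exprn_gt0//.
    rewrite (_ : _ * n%:R ^+ 3 = 2 * n%:R * sigma ^+ 4); last first.
      by field; rewrite gt_eqF.
    by rewrite ltr_pM2r// exprn_gt0.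
  apply: lt_le_trans (ler_wpM2l (ltW (lt_trans coef_gt0 coef_lt)) sq_le).
  by rewrite ltr_pM2r.
rewrite VE; split; congr EFin.
  by apply: V_cubature_gaussian_moments => //; [exact: linear_Q_MS|exact: Q_MS_moments].
apply/esym; apply: V_cubature_gaussian_moments => //; first exact: linear_Q_LD.
exact: Q_LD_moments.
Qed.
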